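(* Let $\Gamma_n$ be a poly-free group given inductively by groups $\Gamma_0,\Gamma_1,\dots,\Gamma_n$ and, for each $1\le k\le n$, an extension $$1\to F_{\alpha(k)}\to\Gamma_k\xrightarrow{\ p\ }\Gamma_{k-1}\to1$$ such that: $\Gamma_0$ is a free group; $F_{\alpha(k)}$ is a free group on a countable set $\alpha(k)$ of cardinality at least two; $p:\Gamma_k\to\Gamma_{k-1}$ is a split epimorphism; and the action of $\Gamma_{k-1}$ on $H_*(F_{\alpha(k)})$ is trivial. Write $F_{\alpha(0)}=\Gamma_0$. Then the center of the Lie algebra $\mathrm{gr}_*(\Gamma_n)$ is cyclic. Furthermore, if $F_{\alpha(k)}$ is of rank at least two for every $k$, $0\le k\le n$, then both the center of $\mathrm{gr}_*(\Gamma_n)$ and the center of the group $\Gamma_n$ are trivial.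
   Context: For a group $G$, put $G_1=G$, $G_{m+1}=[G_m,G]$, $\mathrm{gr}_m(G)=G_m/G_{m+1}$, and $\mathrm{gr}_*(G)=\bigoplus_{m\ge1}\mathrm{gr}_m(G)$, a Lie algebra over $\mathbb{Z}$ with bracket induced by the commutator $[u,v]=uvu^{-1}v^{-1}$. The center of a Lie algebra $\mathfrak{g}$ is $\{a\in\mathfrak{g}:[a,b]=0\text{ for all }b\in\mathfrak{g}\}$. ''Cyclic'' means cyclic as an abelian group (the trivial group is allowed). The action of $\Gamma_{k-1}$ on $H_*(F_{\alpha(k)})$ is the one induced by conjugation in $\Gamma_k$. *)

(* Defs.v *)
From HB Require Import structures.
From mathcomp Require Import all_boot all_order all_algebra.
From mathcomp Require Import boolp classical_sets cardinality.
From mathcomp Require Import freeg.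

Set Implicit Arguments.
Unset Strict Implicit.
Unset Printing Implicit Defensive.

Import GRing.Theory.
Local Open Scope classical_set_scope.
Local Open Scope quotient_scope.
Local Open Scope group_scope.

HB.mixin Record isLieRing L of GRing.Zmodule L := {
  lie : L -> L -> L;
  lieDl : left_distributive lie +%R;
  lieDr : right_distributive lie +%R;
  liexx : forall a, lie a a = 0%R;
  lie_Jacobi : forall a b c,
    (lie (lie a b) c + lie (lie b c) a + lie (lie c a) b = 0)%R }.

(* Lie algebras over Z. *)
#[short(type="lieRingType")]
HB.structure Definition LieRing := { L of isLieRing L & GRing.Zmodule L }.

Definition lie_center (L : lieRingType) : set L :=
  [set a | forall b, lie a b = 0%R].
Arguments lie_center : clear implicits.

Definition cyclic_zmod (V : zmodType) (A : set V) : Prop :=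
  exists2 a, A a & forall b, A b -> exists m : int, b = (a *~ m)%R.

(* The convention [u, v] = u v u^-1 v^-1; MathComp's [~ u, v] is
   u^-1 v^-1 u v. *)
Definition gcomm (G : groupType) (u v : G) : G := u * v * u^-1 * v^-1.

Definition subgroup (G : groupType) (H : set G) : Prop :=
  H 1 /\ forall u v, H u -> H v -> H (u * v^-1).

Definition gcenter (G : groupType) : set G := [set z | forall g, commute z g].
Arguments gcenter : clear implicits.

(* G_m is lcs G m for m >= 1. As with MathComp's 'L_n(G), there is also a
   junk index 0, with lcs G 0 = lcs G 1 = G. *)
Fixpoint lcs_rec (G : groupType) (m : nat) : set G :=
  if m is m'.+1
  then smallest (@subgroup G) [set gcomm u v | u in lcs_rec m' & v in setT]
  else setT.
Definition lcs (G : groupType) (m : nat) : set G := @lcs_rec G m.-1.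
Arguments lcs : clear implicits.

Section LowerCentralSeries.
Variable G : groupType.
Implicit Types (u v w g : G) (H : set G) (i j m : nat).

Lemma smallest_subgroup H : subgroup (smallest (@subgroup G) H).
Proof.
split=> [|u v Hu Hv]; first by move=> K [[]].
by move=> K KH; move: (KH) => [[_ KM] _]; apply: KM; [apply: Hu|apply: Hv].
Qed.

Lemma lcs_subgroup m : subgroup (lcs G m).
Proof.
rewrite /lcs; case: m.-1 => [|k]; first by [].
exact: smallest_subgroup.
Qed.

Lemma lcs1 m : lcs G m 1. Proof. by case: (lcs_subgroup m). Qed.

Lemma lcsF m u v : lcs G m u -> lcs G m v -> lcs G m (u * v^-1).
Proof. by case: (lcs_subgroup m) => _; apply. Qed.

Lemma lcsV m u : lcs G m u -> lcs G m u^-1.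
Proof. by move=> /(lcsF (lcs1 m)); rewrite mul1g. Qed.

Lemma lcsM m u v : lcs G m u -> lcs G m v -> lcs G m (u * v).
Proof. by move=> uL /lcsV; move/(lcsF uL); rewrite invgK. Qed.

Lemma lcs0 u : lcs G 0 u. Proof. by []. Qed.

Lemma lcs1T u : lcs G 1 u. Proof. by []. Qed.

Lemma gcommS m u v : lcs G m u -> lcs G m.+1 (gcomm u v).
Proof.
case: m => [|m] // uL; apply: sub_gen_smallest.
by exists u => //; exists v.
Qed.

Lemma gcommE u v : u * v = gcomm u v * (v * u).
Proof. by rewrite /gcomm !mulgA mulgVK mulgVK. Qed.

Lemma gcommV u v : (gcomm u v)^-1 = gcomm v u.
Proof. by rewrite /gcomm !invgM !invgK !mulgA. Qed.

Lemma gcommJ u v g :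
  g * gcomm u v * g^-1 = gcomm (g * u * g^-1) (g * v * g^-1).
Proof. by rewrite /gcomm !invgM !invgK !mulgA !mulgVK. Qed.

Lemma lcs_sub m : lcs G m.+1 `<=` lcs G m.
Proof.
case: m => [|m] //; elim: m => [|m IHm] //.
apply: smallest_sub; first exact: lcs_subgroup.
by move=> _ [u uL [v _ <-]]; apply: gcommS; apply: IHm.
Qed.

Lemma lcs_le i j : (i <= j)%N -> lcs G j `<=` lcs G i.
Proof.
move=> /subnKC <-; elim: (j - i)%N => [|k IHk]; first by rewrite addn0.
by rewrite addnS => u /lcs_sub; apply: IHk.
Qed.

Lemma lcsJ m u g : lcs G m u -> lcs G m (g * u * g^-1).
Proof.
move=> uL; have -> : g * u * g^-1 = gcomm g u * u by rewrite /gcomm mulgVK.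
by apply: lcsM => //; rewrite -gcommV; apply/lcsV/lcs_sub/gcommS.
Qed.

Lemma gcommMl u v w : gcomm (u * v) w = (u * gcomm v w * u^-1) * gcomm u w.
Proof. by rewrite /gcomm !invgM !mulgA !mulgVK. Qed.

Lemma gcommVl u w : gcomm u^-1 w = u^-1 * (gcomm u w)^-1 * u.
Proof. by rewrite /gcomm !invgM !invgK !mulgA mulgVK. Qed.

(* One form of the Hall-Witt identity. *)
Lemma Hall_Witt u v w :
  gcomm (gcomm u v) (v * w * v^-1) * gcomm (gcomm v w) (w * u * w^-1) *
  gcomm (gcomm w u) (u * v * u^-1) = 1.
Proof.
rewrite /gcomm !invgM !invgK !mulgA.
by rewrite !(mulgVK, mulgK, mulgV, mulVg, mul1g).
Qed.

Lemma gcomm_lcs i j u v :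
  lcs G i u -> lcs G j v -> lcs G (i + j) (gcomm u v).
Proof.
elim: i => [|i IHi] in j u v *.
  by move=> _ vL; rewrite -gcommV; apply/lcsV/lcs_sub/gcommS.
case: i => [|i] in IHi *.
  by move=> _ vL; rewrite -gcommV; apply/lcsV/gcommS.
move=> uL; move: u uL j v.
set K := [set u | forall j v, lcs G j v -> lcs G (i.+2 + j) (gcomm u v)].
suff: lcs G i.+2 `<=` K by move=> sK u uL; apply: (sK u uL).
have KJ m x y : lcs G m x -> lcs G m (y^-1 * x * y).
  by move=> xL; rewrite -{2}[y]invgK; apply: lcsJ.
have KM x y : K x -> K y -> K (x * y).
  move=> Kx Ky j v vL; rewrite gcommMl.
  by apply: lcsM; [apply: lcsJ; apply: Ky|apply: Kx].
have KV x : K x -> K x^-1.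
  by move=> Kx j v vL; rewrite gcommVl; apply/KJ/lcsV; apply: Kx.
apply: smallest_sub.
  split=> [j v vL|x y Kx Ky]; last by apply: KM => //; apply: KV.
  by rewrite /gcomm mul1g invg1 mulg1 mulgV; apply: lcs1.
move=> _ [a aL [b _ <-]] j v vL.
have wL : lcs G j (b^-1 * v * b) by apply: KJ.
move: (Hall_Witt a b (b^-1 * v * b)).
set w := b^-1 * v * b in wL *.
have -> : b * w * b^-1 = v by rewrite /w !mulgA mulgV mul1g mulgK.
rewrite -mulgA => /(canRL (mulgK _)); rewrite mul1g => ->.
apply/lcsV/lcsM.
  rewrite -gcommV; apply: lcsV; rewrite addSnnS.
  by apply: IHi; [apply: lcsJ|rewrite -gcommV; apply/lcsV/gcommS].
apply: gcommS; rewrite -gcommV; apply/lcsV; exact: IHi.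
Qed.

(* gr_m(G) = G_m / G_{m+1}. *)
Definition gr_rel m (u v : lcs G m) : bool :=
  `[< lcs G m.+1 (val u * (val v)^-1) >].

Lemma gr_rel_equiv m : equiv_class_of (@gr_rel m).
Proof.
split=> [u|u v|v u w].
- by apply/asboolP; rewrite mulgV; apply: lcs1.
- by apply/asboolP/asboolP => /lcsV; rewrite invgM invgK.
move=> /asboolP uv /asboolP vw; apply/asboolP.
by move: (lcsM uv vw); rewrite !mulgA mulgVK.
Qed.

Canonical gr_equiv m := EquivRelPack (gr_rel_equiv m).
Definition gr m := {eq_quot (gr_equiv m)}.
HB.instance Definition _ m := Choice.on (gr m).
HB.instance Definition _ m := EqQuotient.on (gr m).

Definition lcs_one m : lcs G m := exist _ 1 (mem_set (lcs1 m)).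

(* The class of u in gr_m(G); it is 0 if u is not in G_m. *)
Definition gr_class m u : gr m := \pi_(gr m) (insubd (lcs_one m) u).

Lemma gr_class_eq m u v : lcs G m u -> lcs G m v ->
  gr_class m u = gr_class m v <-> lcs G m.+1 (u * v^-1).
Proof.
move=> uL vL; rewrite /gr_class.
have -> : lcs G m.+1 (u * v^-1)
    = lcs G m.+1 (val (insubd (lcs_one m) u) * (val (insubd (lcs_one m) v))^-1).
  by rewrite !val_insubd !mem_set.
split=> [/eqmodP/asboolP //|uv].
by apply/eqmodP/asboolP.
Qed.

Lemma gr_classP m (x : gr m) : {u | lcs G m u & x = gr_class m u}.
Proof.
exists (val (repr x)); first exact: set_mem (valP (repr x)).
by rewrite /gr_class valKd reprK.
Qed.

Definition gr_add m (x y : gr m) : gr m :=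
  gr_class m (val (repr x) * val (repr y)).
Definition gr_opp m (x : gr m) : gr m := gr_class m (val (repr x))^-1.

Lemma repr_lcs m (x : gr m) : lcs G m (val (repr x)).
Proof. exact: set_mem (valP (repr x)). Qed.

Lemma gr_class_repr m (x : gr m) : gr_class m (val (repr x)) = x.
Proof. by rewrite /gr_class valKd reprK. Qed.

Lemma repr_gr_class m u : lcs G m u ->
  lcs G m.+1 (val (repr (gr_class m u)) * u^-1).
Proof.
by move=> uL; apply/gr_class_eq => //; [exact: repr_lcs|rewrite gr_class_repr].
Qed.

Lemma gr_class_add m u v : lcs G m u -> lcs G m v ->
  gr_class m (u * v) = gr_add (gr_class m u) (gr_class m v).
Proof.
move=> uL vL; set x := gr_class m u; set y := gr_class m v.
have := repr_gr_class uL; have := repr_gr_class vL.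
have := repr_lcs x; have := repr_lcs y.
rewrite -/x -/y /gr_add; set v' := val _; set u' := val _ => v'L u'L vv uu.
apply/gr_class_eq; [exact: lcsM|exact: lcsM|].
have -> : u * v * (u' * v')^-1
    = u * (v' * v^-1)^-1 * u^-1 * (u' * u^-1)^-1.
  by rewrite !invgM !invgK !mulgA mulgVK.
by apply: lcsM; [apply/lcsJ/lcsV|apply: lcsV].
Qed.

Lemma gr_class_opp m u : lcs G m u ->
  gr_class m u^-1 = gr_opp (gr_class m u).
Proof.
move=> uL; set x := gr_class m u.
have := repr_gr_class uL; have := repr_lcs x.
rewrite -/x /gr_opp; set u' := val _ => u'L uu.
apply/gr_class_eq; [exact: lcsV|exact: lcsV|].
have -> : u^-1 * u'^-1^-1 = u^-1 * (u' * u^-1) * u^-1^-1.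
  by rewrite !invgK !mulgA mulgVK.
exact: lcsJ.
Qed.

Lemma gr_addA m : associative (@gr_add m).
Proof.
move=> x y z; case: (gr_classP x) (gr_classP y) (gr_classP z).
move=> u uL -> [v vL ->] [w wL ->].
by rewrite -!gr_class_add ?mulgA //; apply: lcsM.
Qed.

Lemma gr_addC m : commutative (@gr_add m).
Proof.
move=> x y; case: (gr_classP x) (gr_classP y) => u uL -> [v vL ->].
rewrite -!gr_class_add //; apply/gr_class_eq; [exact: lcsM|exact: lcsM|].
by rewrite invgM mulgA; apply: gcommS.
Qed.

Lemma gr_add0 m : left_id (gr_class m 1) (@gr_add m).
Proof.
move=> x; have [u uL ->] := gr_classP x.
by rewrite -gr_class_add ?mul1g //; apply: lcs1.
Qed.

Lemma gr_addN m : left_inverse (gr_class m 1) (@gr_opp m) (@gr_add m).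
Proof.
move=> x; have [u uL ->] := gr_classP x.
by rewrite -gr_class_opp // -gr_class_add ?mulVg //; apply: lcsV.
Qed.

HB.instance Definition _ m := GRing.isZmodule.Build (gr m)
  (@gr_addA m) (@gr_addC m) (@gr_add0 m) (@gr_addN m).

Lemma gr_classM m u v : lcs G m u -> lcs G m v ->
  gr_class m (u * v) = (gr_class m u + gr_class m v)%R.
Proof. exact: gr_class_add. Qed.

Lemma gr_classV m u : lcs G m u -> gr_class m u^-1 = (- gr_class m u)%R.
Proof. exact: gr_class_opp. Qed.

Lemma gr_class1 m : gr_class m 1 = 0%R. Proof. by []. Qed.

Lemma gr_class_eq0 m u : lcs G m u -> gr_class m u = 0%R <-> lcs G m.+1 u.
Proof.
move=> uL; rewrite -gr_class1 -{2}[u]mulg1 -{2}[1]invg1.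
by apply: gr_class_eq => //; apply: lcs1.
Qed.

Lemma gr0_trivial (x : gr 0) : x = 0%R.
Proof. by have [u uL ->] := gr_classP x; apply/gr_class_eq0. Qed.

(* The direct sum of the gr_m(G) over all m >= 1: the summand of index 0 is
   trivial by gr0_trivial. *)
Record gr_star := GrStar {
  gr_coord :> forall m, gr m;
  gr_coord_finite : exists N, forall m, (N <= m)%N -> gr_coord m = 0%R }.

Lemma gr_starP (a b : gr_star) : (forall m, a m = b m) -> a = b.
Proof.
case: a b => [a fa] [b fb] /= ab.
have abE : a = b by apply: functional_extensionality_dep.
by subst b; congr GrStar; apply: Prop_irrelevance.
Qed.

HB.instance Definition _ := gen_eqMixin gr_star.
HB.instance Definition _ := gen_choiceMixin gr_star.

Lemma gr_star0_subproof : exists N, forall m, (N <= m)%N -> 0%R = 0%R :> gr m.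
Proof. by exists 0%N. Qed.
Definition gr_star0 := GrStar gr_star0_subproof.

Lemma gr_starD_subproof (a b : gr_star) :
  exists N, forall m, (N <= m)%N -> (a m + b m = 0)%R.
Proof.
have [N aN] := gr_coord_finite a; have [M bM] := gr_coord_finite b.
exists (maxn N M) => m; rewrite geq_max => /andP[/aN -> /bM ->].
by rewrite addr0.
Qed.
Definition gr_starD a b := GrStar (gr_starD_subproof a b).

Lemma gr_starN_subproof (a : gr_star) :
  exists N, forall m, (N <= m)%N -> (- a m = 0)%R.
Proof.
by have [N aN] := gr_coord_finite a; exists N => m /aN ->; rewrite oppr0.
Qed.
Definition gr_starN a := GrStar (gr_starN_subproof a).

Lemma gr_starDA : associative gr_starD.
Proof. by move=> a b c; apply: gr_starP => m /=; rewrite addrA. Qed.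
Lemma gr_starDC : commutative gr_starD.
Proof. by move=> a b; apply: gr_starP => m /=; rewrite addrC. Qed.
Lemma gr_starD0 : left_id gr_star0 gr_starD.
Proof. by move=> a; apply: gr_starP => m /=; rewrite add0r. Qed.
Lemma gr_starDN : left_inverse gr_star0 gr_starN gr_starD.
Proof. by move=> a; apply: gr_starP => m /=; rewrite addNr. Qed.

HB.instance Definition _ := GRing.isZmodule.Build gr_star
  gr_starDA gr_starDC gr_starD0 gr_starDN.

Lemma gr_coordD (a b : gr_star) m : (a + b)%R m = (a m + b m)%R.
Proof. by []. Qed.

(* The bracket of the classes of u in gr_i(G) and v in gr_j(G) is the class of
   [u, v] in gr_{i+j}(G); k stands for i + j. *)
Definition gr_lie i j k (x : gr i) (y : gr j) : gr k :=
  gr_class k (gcomm (val (repr x)) (val (repr y))).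

Lemma gr_classJ m u g : lcs G m u -> gr_class m (g * u * g^-1) = gr_class m u.
Proof.
move=> uL; apply/gr_class_eq => //; first exact: lcsJ.
by rewrite -[_ * _ * _]/(gcomm g u) -gcommV; apply/lcsV/gcommS.
Qed.

Lemma gr_class_gcommC m u v :
  lcs G m (gcomm u v) -> gr_class m (gcomm u v) = (- gr_class m (gcomm v u))%R.
Proof. by move=> uvL; rewrite -(gcommV u v) gr_classV ?opprK. Qed.

Lemma gr_class_gcommMl i j u v w : lcs G i u -> lcs G i v -> lcs G j w ->
  gr_class (i + j) (gcomm (u * v) w)
  = (gr_class (i + j) (gcomm u w) + gr_class (i + j) (gcomm v w))%R.
Proof.
move=> uL vL wL; have [uw vw] := (gcomm_lcs uL wL, gcomm_lcs vL wL).
by rewrite gcommMl gr_classM ?gr_classJ 1?addrC //; apply: lcsJ.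
Qed.

Lemma gr_class_gcommMr i j u v w : lcs G i u -> lcs G j v -> lcs G j w ->
  gr_class (i + j) (gcomm u (v * w))
  = (gr_class (i + j) (gcomm u v) + gr_class (i + j) (gcomm u w))%R.
Proof.
move=> uL vL wL; have vwL := lcsM vL wL.
rewrite !(gr_class_gcommC (gcomm_lcs uL _)) // addnC.
by rewrite (gr_class_gcommMl vL wL uL) opprD.
Qed.

Lemma gr_lieE i j k u v : (i + j)%N = k -> lcs G i u -> lcs G j v ->
  gr_lie k (gr_class i u) (gr_class j v) = gr_class k (gcomm u v).
Proof.
move=> <- uL vL; set x := gr_class i u; set y := gr_class j v.
have := repr_gr_class uL; have := repr_gr_class vL.
rewrite -/x -/y /gr_lie; have := repr_lcs x; have := repr_lcs y.
set v' := val _; set u' := val _ => v'L u'L vv uu.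
have uuL := lcs_sub uu; have vvL := lcs_sub vv.
have aL : lcs G (i + j).+1 (gcomm (u' * u^-1) v').
  by rewrite -addSn; apply: gcomm_lcs.
have bL : lcs G (i + j).+1 (gcomm u (v' * v^-1)).
  by rewrite -addnS; apply: gcomm_lcs.
rewrite -[u'](mulgVK u) gr_class_gcommMl // (gr_class_eq0 _).2 ?add0r //;
  last exact: lcs_sub.
rewrite -[v'](mulgVK v) gr_class_gcommMr // (gr_class_eq0 _).2 ?add0r //.
exact: lcs_sub.
Qed.

Lemma gr_lieDl i j k (x y : gr i) (z : gr j) : (i + j)%N = k ->
  gr_lie k (x + y)%R z = (gr_lie k x z + gr_lie k y z)%R.
Proof.
move=> ijk; case: (gr_classP x) (gr_classP y) (gr_classP z).
move=> u uL -> [v vL ->] [w wL ->].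
rewrite -gr_classM // !gr_lieE //; last exact: lcsM.
by rewrite -ijk gr_class_gcommMl.
Qed.

Lemma gr_lieDr i j k (x : gr i) (y z : gr j) : (i + j)%N = k ->
  gr_lie k x (y + z)%R = (gr_lie k x y + gr_lie k x z)%R.
Proof.
move=> ijk; case: (gr_classP x) (gr_classP y) (gr_classP z).
move=> u uL -> [v vL ->] [w wL ->].
rewrite -gr_classM // !gr_lieE //; last exact: lcsM.
by rewrite -ijk gr_class_gcommMr.
Qed.

Lemma gr_lie0r i j k (y : gr j) : (i + j)%N = k -> gr_lie k (0 : gr i)%R y = 0%R.
Proof.
by move=> ijk; apply: (addrI (gr_lie k (0 : gr i)%R y)); rewrite -gr_lieDl ?addr0.
Qed.

Lemma gr_lier0 i j k (x : gr i) : (i + j)%N = k -> gr_lie k x (0 : gr j)%R = 0%R.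
Proof.
by move=> ijk; apply: (addrI (gr_lie k x (0 : gr j)%R)); rewrite -gr_lieDr ?addr0.
Qed.

Definition gr_star_lie_coord (a b : gr_star) m : gr m :=
  (\sum_(i < m.+1) gr_lie m (a i) (b (m - i)%N))%R.

Lemma gr_star_lie_subproof a b :
  exists N, forall m, (N <= m)%N -> gr_star_lie_coord a b m = 0%R.
Proof.
have [N aN] := gr_coord_finite a; have [M bM] := gr_coord_finite b.
exists (N + M)%N => m NMm; apply: big1 => i _.
have im : (i + (m - i))%N = m by rewrite subnKC // -ltnS.
have [/aN ->|iN] := leqP N i; first exact: gr_lie0r.
rewrite bM ?gr_lier0 // leq_subRL -1?ltnS //.
by apply: leq_trans NMm; rewrite leq_add2r ltnW.
Qed.

Definition gr_star_lie a b := GrStar (gr_star_lie_subproof a b).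

Lemma gr_star_lieDl : left_distributive gr_star_lie +%R.
Proof.
move=> a b c; apply: gr_starP => m; rewrite [RHS]gr_coordD -big_split /=.
by apply: eq_bigr => i _; rewrite gr_coordD gr_lieDl // subnKC // -ltnS.
Qed.

Lemma gr_star_lieDr : right_distributive gr_star_lie +%R.
Proof.
move=> a b c; apply: gr_starP => m; rewrite [RHS]gr_coordD -big_split /=.
by apply: eq_bigr => i _; rewrite gr_coordD gr_lieDr // subnKC // -ltnS.
Qed.

(* The homogeneous element of degree i given by the class of u. *)
Lemma gr_hom_subproof i u :
  exists N, forall m, (N <= m)%N -> (if m == i then gr_class m u else 0)%R = 0%R.
Proof. by exists i.+1 => m; case: eqVneq => // ->; rewrite ltnn. Qed.
Definition gr_hom i u := GrStar (gr_hom_subproof i u).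

Lemma gr_homM i u v : lcs G i u -> lcs G i v ->
  gr_hom i (u * v) = (gr_hom i u + gr_hom i v)%R.
Proof.
move=> uL vL; apply: gr_starP => m; rewrite gr_coordD /=.
by case: eqP => [->|_]; rewrite ?gr_classM ?addr0.
Qed.

Lemma gr_hom0 i u : lcs G i.+1 u -> gr_hom i u = 0%R.
Proof.
move=> uL; apply: gr_starP => m /=; case: eqP => // ->.
by apply/gr_class_eq0; first apply: lcs_sub.
Qed.

Lemma gr_homJ i u g : lcs G i u -> gr_hom i (g * u * g^-1) = gr_hom i u.
Proof.
move=> uL; apply: gr_starP => m /=; case: eqP => // ->; exact: gr_classJ.
Qed.

Lemma gr_hom_lie i j u v : lcs G i u -> lcs G j v ->
  gr_star_lie (gr_hom i u) (gr_hom j v) = gr_hom (i + j) (gcomm u v).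
Proof.
move=> uL vL; apply: gr_starP => m /=; rewrite /gr_star_lie_coord /=.
have E (k : 'I_m.+1) : (k + (m - k))%N = m by rewrite subnKC // -ltnS.
case: eqP => [mij|mij]; last first.
  apply: big1 => k _; case: eqP => ki; last by rewrite gr_lie0r.
  case: eqP => kj; last by rewrite gr_lier0.
  by case: mij; rewrite -ki -kj E.
have im : (i < m.+1)%N by rewrite ltnS mij leq_addr.
have jE : (m - i)%N = j by rewrite mij addKn.
rewrite (bigD1 (Ordinal im)) //= big1 => [|k ki]; last first.
  by case: eqP => [kE|]; [case/eqP: ki; apply: val_inj|rewrite gr_lie0r].
by rewrite addr0 eqxx jE eqxx; apply: gr_lieE.
Qed.

Lemma gr_star_ind (P : gr_star -> Prop) : P 0%R ->
  (forall a i u, lcs G i u -> P a -> P (a + gr_hom i u)%R) -> forall a, P a.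
Proof.
move=> P0 PD a; have [N] := gr_coord_finite a.
elim: N => [|N IHN] in a *.
  by move=> a0; have -> : a = 0%R by apply: gr_starP => m; apply: a0.
move=> aN; have [u uL uE] := gr_classP (a N).
rewrite -[a](subrK (gr_hom N u)); apply: PD => //; apply: IHN => m.
rewrite leq_eqVlt gr_coordD /= -[X in (_ + X)%R]/(- gr_hom N u m)%R /=.
case: (eqVneq m N) => [-> _|mN]; first by rewrite uE subrr.
by rewrite oppr0 addr0 => /aN.
Qed.

Lemma gr_star_lie0r a : gr_star_lie 0%R a = 0%R.
Proof. by apply: (addrI (gr_star_lie 0%R a)); rewrite -gr_star_lieDl ?addr0. Qed.

Lemma gr_star_lier0 a : gr_star_lie a 0%R = 0%R.
Proof. by apply: (addrI (gr_star_lie a 0%R)); rewrite -gr_star_lieDr ?addr0. Qed.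

Lemma gr_star_lie_anti a b : (gr_star_lie a b + gr_star_lie b a)%R = 0%R.
Proof.
elim/gr_star_ind: a => [|a i u uL IHa].
  by rewrite gr_star_lie0r gr_star_lier0 addr0.
rewrite gr_star_lieDl gr_star_lieDr addrACA IHa add0r.
elim/gr_star_ind: b {IHa} => [|b j v vL IHb].
  by rewrite gr_star_lie0r gr_star_lier0 addr0.
rewrite gr_star_lieDl gr_star_lieDr addrACA IHb add0r.
have uvL := gcomm_lcs uL vL; have vuL := gcomm_lcs vL uL.
rewrite !gr_hom_lie // [(j + i)%N]addnC -gr_homM //; last by rewrite addnC.
by rewrite -(gcommV u v) mulgV gr_hom0 //; apply: lcs1.
Qed.

Lemma gr_star_liexx a : gr_star_lie a a = 0%R.
Proof.
elim/gr_star_ind: a => [|a i u uL IHa]; first exact: gr_star_lie0r.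
rewrite gr_star_lieDl !gr_star_lieDr IHa add0r addrA gr_star_lie_anti add0r.
by rewrite gr_hom_lie // /gcomm mulgK mulgV gr_hom0 //; apply: lcs1.
Qed.

Lemma gr_star_lie_Jacobi a b c :
  (gr_star_lie (gr_star_lie a b) c + gr_star_lie (gr_star_lie b c) a
   + gr_star_lie (gr_star_lie c a) b = 0)%R.
Proof.
have add3 (x y z x' y' z' : gr_star) :
    (x + y + z = 0 -> x' + y' + z' = 0 ->
     (x + x') + (y + y') + (z + z') = 0)%R.
  by move=> e e'; rewrite (addrACA x x') (addrACA (x + y)%R) e e' addr0.
elim/gr_star_ind: a => [|a i u uL IHa].
  by rewrite !(gr_star_lie0r, gr_star_lier0) !addr0.
rewrite !(gr_star_lieDl, gr_star_lieDr); apply: (add3) => // {a IHa}.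
elim/gr_star_ind: b => [|b j v vL IHb].
  by rewrite !(gr_star_lie0r, gr_star_lier0) !addr0.
rewrite !(gr_star_lieDl, gr_star_lieDr); apply: (add3) => // {b IHb}.
elim/gr_star_ind: c => [|c k w wL IHc].
  by rewrite !(gr_star_lie0r, gr_star_lier0) !addr0.
rewrite !(gr_star_lieDl, gr_star_lieDr); apply: (add3) => // {c IHc}.
have [uv vw wu] := And3 (gcomm_lcs uL vL) (gcomm_lcs vL wL) (gcomm_lcs wL uL).
have uvw := gcomm_lcs uv (lcsJ v wL).
have vwu := gcomm_lcs vw (lcsJ w uL).
have wuv := gcomm_lcs wu (lcsJ u vL).
rewrite (gr_hom_lie uL vL) (gr_hom_lie vL wL) (gr_hom_lie wL uL).
rewrite -(gr_homJ v wL) -(gr_homJ w uL) -(gr_homJ u vL) !gr_hom_lie //;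
  try exact: lcsJ.
have e1 : (j + k + i = i + j + k)%N by rewrite addnC addnA.
have e2 : (k + i + j = i + j + k)%N by rewrite -addnA addnC.
rewrite e1 in vwu *; rewrite e2 in wuv *.
rewrite -!gr_homM ?Hall_Witt //; last exact: lcsM.
by apply: gr_hom0; apply: lcs1.
Qed.

HB.instance Definition _ := isLieRing.Build gr_star gr_star_lieDl gr_star_lieDr
  gr_star_liexx gr_star_lie_Jacobi.

End LowerCentralSeries.

(* F is free on B: the universal property, where only the restriction to B of
   the function f matters. *)
Definition free_on (F : groupType) (B : set F) : Prop :=
  (forall (H : groupType) (f : F -> H),
     exists phi : {multiplicative F -> H}, forall x, B x -> phi x = f x) /\
  (forall (H : groupType) (phi psi : {multiplicative F -> H}),
     (forall x, B x -> phi x = psi x) -> phi =1 psi).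

Section GroupHomology.
Local Open Scope ring_scope.

(* The inhomogeneous bar complex with integer coefficients: the basis element
   [g_0|...|g_(n-1)] of bar G n is << [tuple g_0; ...; g_(n-1)] >>. *)
Definition bar (G : groupType) (n : nat) := {freeg (n.-tuple G) / int}.

(* The i-th face of [g_0|...|g_n], for 0 <= i <= n.+1: it drops g_0 if i = 0,
   drops g_n if i = n.+1 and multiplies g_(i-1) by g_i otherwise. *)
Definition bar_face (G : groupType) (n : nat) (i : 'I_n.+2)
    (g : n.+1.-tuple G) : n.-tuple G :=
  [tuple let x := tnth g (widen_ord (leqnSn n) k) in
         let y := tnth g (fintype.lift ord0 k) in
         if (k.+1 < i)%N then x else if k.+1 == i then (x * y)%g else y
  | k < n].

Definition bar_d (G : groupType) (n : nat) : bar G n.+1 -> bar G n :=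
  fglift (fun g => \sum_(i < n.+2) (-1) ^+ i *: << bar_face i g >>).

Definition bar_map (G H : groupType) (f : G -> H) (n : nat) :
    bar G n -> bar H n :=
  fglift (fun g => << map_tuple f g >>).

Definition bar_cycle (G : groupType) (n : nat) : set (bar G n) :=
  if n is n'.+1 then [set z | bar_d z = 0] else setT.

Definition bar_homologous (G : groupType) (n : nat) (z z' : bar G n) : Prop :=
  exists w : bar G n.+1, z - z' = bar_d w.

(* f induces the identity on H_*(G; Z). *)
Definition homology_trivial (G : groupType) (f : {multiplicative G -> G}) :
    Prop :=
  forall (n : nat) (z : bar G n), bar_cycle z -> bar_homologous (bar_map f z) z.

End GroupHomology.

(* F_alpha(k), where N k is the kernel F_alpha(k+1) of the extension
   1 -> N k -> Gam k.+1 -> Gam k -> 1 and F_alpha(0) stands for Gam 0. *)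
Definition polyfree_factor (Gam N : nat -> groupType) (k : nat) : groupType :=
  if k is k'.+1 then N k' else Gam 0%N.

(* Main.v *)
From HB Require Import structures.
Require Import Defs.
From mathcomp Require Import all_boot all_order all_algebra.
From mathcomp Require Import boolp classical_sets functions cardinality freeg.

(** Consider one of the extensions 1 -> A -> G -> B -> 1. Its kernel A is free
of rank at least two, it splits, and G acts trivially on the abelianization of
A. The last condition says that [G, A_m] lies in A_(m+1) for m = 1, hence for
all m, and the three subgroups lemma improves this to [G_k, A_m] in A_(k+m)
(gcomm_jlcs). Together with the splitting this gives that A_m is the
intersection of A and G_m (lcs_j), so gr_*(A) is the kernel of
gr_*(G) -> gr_*(B). A central element of gr_*(G) that dies in gr_*(B) thus
comes from gr_*(A) and is central there; as gr_*(A) has trivial centre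
(free_gr_center), the centre of gr_*(G) embeds in that of gr_*(B)
(lie_center_map_inj). By induction the centre of gr_*(Gamma_n) embeds in the
centre of gr_*(Gamma_0), which is trivial if Gamma_0 has rank at least two, and
which is cyclic if Gamma_0 has rank at most one, since then gr_*(Gamma_0) is
itself cyclic. The centre of the group Gamma_n is treated in the same way, from
the triviality of the centre of a free group of rank at least two
(free_center_trivial).

The substance is that gr_*(F) has trivial centre when F is free of rank at least
two. An element x of F_m is described by a Lie polynomial e of degree m in the
generators: the class of x is the value of e in gr_*(F), and whenever the
generators b act on the power series with coefficients in a module V as
1 + t rho_b, with rho_b an arbitrary endomorphism of V, the element x acts as
1 + t^m e(rho) + ... (represents_ex). If the class of x is central, then
e(rho) commutes with all rho_b, for all V and rho, and applying this to a
suitable module built from V gives e(rho) = 0 (vanishes_commuting). It remains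
to see that a Lie polynomial with e(rho) = 0 for all V and rho has the value 0
in every Lie ring, in particular in gr_*(F) (lev_vanishes). This is a form of
Witt's theorem that the Lie subring generated by the variables of a free
associative ring is free.

Witt's theorem is proved by Lazard elimination: a Lie polynomial is an integer
multiple of a chosen variable a plus a Lie polynomial in the elements
ad(a)^k x with x <> a. If it vanishes on all modules, so does the new one
(vanishes_Lelim): let a act on the sequences in V by the shift and x by
multiplication with a Hurwitz series of endomorphisms; then ad(a)^k x acts by a
series whose constant term is the k-th coefficient of the first one, and these
coefficients are arbitrary. Eliminating variables of least weight
raises the least weight until it exceeds the degree, and then nothing is
left. *)

Set Implicit Arguments.
Unset Strict Implicit.
Unset Printing Implicit Defensive.

Import GRing.Theory.
Local Open Scope classical_set_scope.
Local Open Scope group_scope.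

(** * Homomorphisms, permutation groups and generation *)

Section Morphisms.
Variables (G H : groupType) (f : {multiplicative G -> H}).

Lemma hom1 : f 1 = 1.
Proof. by apply: (mulgI (f 1)); rewrite -gmulfM !mulg1. Qed.

Lemma homV x : f x^-1 = (f x)^-1.
Proof. by apply: (mulgI (f x)); rewrite -gmulfM !mulgV hom1. Qed.

Lemma hom_gcomm x y : f (gcomm x y) = gcomm (f x) (f y).
Proof. by rewrite /gcomm !gmulfM !homV. Qed.

Lemma hom_lcs m x : lcs G m x -> lcs H m (f x).
Proof.
case: m => [|m] //; elim: m x => [|m IHm] // x xL.
suff: lcs G m.+2 `<=` [set y | lcs H m.+2 (f y)] by apply.
apply: smallest_sub => [|_ [u uL [v _ <-]] /=].
  split=> [|u v /= uL vL]; first by rewrite /= hom1; apply: lcs1.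
  by rewrite gmulfM homV; apply: lcsF.
by rewrite hom_gcomm; apply: (@gcommS _ m.+1); apply: IHm.
Qed.

End Morphisms.

Definition mk_hom (G H : groupType) (f : G -> H)
    (fM : {morph f : x y / x * y}) : {multiplicative G -> H} :=
  HB.pack_for {multiplicative G -> H} f (isMultiplicative.Build G H f fM).

Lemma gcomm1g (G : groupType) (u : G) : gcomm 1 u = 1.
Proof. by rewrite /gcomm mul1g invg1 mulg1 mulgV. Qed.

Section Bijections.
Variable T : Type.

(** The inverse is part of the data, so that the group operations need no
choice; it is determined by the function (bijP). *)
Record bij := Bij {
  bij_fun :> T -> T;
  bij_inv : T -> T;
  bij_funK : cancel bij_fun bij_inv;
  bij_invK : cancel bij_inv bij_fun }.

Lemma bijP (f g : bij) : f =1 g -> f = g.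
Proof.
case: f g => [f f' fK f'K] [g g' gK g'K] /= fg.
have fgE : f = g by apply: funext.
subst g; have f'g' : f' = g' by apply: funext => x; rewrite -{1}[x]g'K fK.
by subst g'; congr Bij; apply: Prop_irrelevance.
Qed.

HB.instance Definition _ := gen_eqMixin bij.
HB.instance Definition _ := gen_choiceMixin bij.

Definition bij1 := @Bij id id (fun=> erefl) (fun=> erefl).
Definition bijM (f g : bij) := @Bij (f \o g) (bij_inv g \o bij_inv f)
  (can_comp (bij_funK f) (bij_funK g)) (can_comp (bij_invK g) (bij_invK f)).
Definition bijV (f : bij) := Bij (bij_invK f) (bij_funK f).

Lemma bijMA : associative bijM. Proof. by move=> f g h; apply: bijP. Qed.
Lemma bij1M : left_id bij1 bijM. Proof. by move=> f; apply: bijP. Qed.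
Lemma bijM1 : right_id bij1 bijM. Proof. by move=> f; apply: bijP. Qed.
Lemma bijVM : left_inverse bij1 bijV bijM.
Proof. by move=> f; apply: bijP => x /=; rewrite bij_funK. Qed.
Lemma bijMV : right_inverse bij1 bijV bijM.
Proof. by move=> f; apply: bijP => x /=; rewrite bij_invK. Qed.

HB.instance Definition _ := isGroup.Build bij bijMA bij1M bijM1 bijVM bijMV.

Lemma bijME (f g : bij) x : (f * g) x = f (g x). Proof. by []. Qed.

Lemma bijVK (f : bij) x : f (f^-1 x) = x.
Proof. exact: (bij_invK f). Qed.

Lemma bijKV (f : bij) x : f^-1 (f x) = x.
Proof. exact: (bij_funK f). Qed.

End Bijections.

Lemma ltransK (F : groupType) (T : Type) (x : F) :
  cancel (fun u : F * T => (x * u.1, u.2)) (fun u => (x^-1 * u.1, u.2)).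
Proof. by case=> y b /=; rewrite mulKg. Qed.

Lemma ltransVK (F : groupType) (T : Type) (x : F) :
  cancel (fun u : F * T => (x^-1 * u.1, u.2)) (fun u => (x * u.1, u.2)).
Proof. by case=> y b /=; rewrite mulVKg. Qed.

Definition ltrans (F : groupType) (T : Type) (x : F) : bij (F * T) :=
  Bij (@ltransK F T x) (@ltransVK F T x).

Lemma ltransM (F : groupType) (T : Type) :
  {morph @ltrans F T : x y / x * y}.
Proof. by move=> x y; apply: bijP => -[z b] /=; rewrite mulgA. Qed.

(** Let F act on two copies of itself by left translations, and let s exchange
the two copies of each point of K. For x in B, and hence for all x by
uniqueness, s commutes with the translation by x; this means x K = K. *)
Lemma free_gen (F : groupType) (B K : set F) :
  free_on B -> subgroup K -> B `<=` K -> forall x, K x.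
Proof.
move=> [_ uniq] [K1 KF] BK x.
have KV y : K y -> K y^-1 by move=> /(KF _ _ K1); rewrite mul1g.
have KM y z : K y -> K z -> K (y * z).
  by move=> Ky /KV Kz; rewrite -[z]invgK; apply: KF.
pose s (u : F * bool) := (u.1, u.2 (+) `[<K u.1>]).
have sK : involutive s by case=> y b; rewrite /s /= addbK.
pose sB : bij (F * bool) := Bij sK sK.
have ssE : sB * sB = 1 by apply: bijP => u; apply: sK.
pose L : {multiplicative F -> bij (F * bool)} := mk_hom (@ltransM F bool).
have LsM : {morph (fun y => sB * L y * sB) : y z / y * z}.
  move=> y z; rewrite gmulfM !mulgA; congr (_ * _ * _).
  by rewrite -[RHS]mulgA ssE mulg1.
suff /(uniq _ L (mk_hom LsM))/(_ x) : forall y, B y -> L y = mk_hom LsM y.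
  move=> /(congr1 (fun f : bij _ => (f (1, false)).2)) /=.
  by rewrite mulg1 (asboolT K1) /= => /esym/negbFE/asboolP.
move=> y /BK Ky; apply: bijP => -[z b] /=; rewrite /s /=; congr pair.
have -> : `[<K (y * z)>] = `[<K z>].
  apply/asboolP/asboolP => [Kyz|]; last exact: KM.
  by rewrite -[z](mulKg y); apply: KM => //; apply: KV.
by rewrite addbK.
Qed.

(** * The centre of a free group of rank at least two *)

Lemma card_ge2 (T : Type) (A : set T) : (`I_2 #<= A)%card ->
  exists a b, [/\ A a, A b & a <> b].
Proof.
case/card_leP => f.
have I0 : (0 : nat)%N \in `I_2 by rewrite inE.
have I1 : (1 : nat)%N \in `I_2 by rewrite inE.
exists (val (f (SigSub I0))), (val (f (SigSub I1))); split.
- exact: set_valP.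
- exact: set_valP.
move=> /val_inj/(@inj _ _ _ f); rewrite !inE.
by move=> /(_ Logic.I Logic.I) /(congr1 val).
Qed.

Lemma card_ge2_intro (T : Type) (A : set T) a b :
  A a -> A b -> a <> b -> (`I_2 #<= A)%card.
Proof.
move=> Aa Ab ab; pose g i := if i is 0%N then a else b.
have g_inj : {in `I_2 &, injective g}.
  by move=> [|[|i]] [|[|k]]; rewrite !inE //= => _ _ e; case: ab.
rewrite -(card_le_eql (inj_card_eq g_inj)); apply: subset_card_le.
by move=> _ [[|i] _ <-].
Qed.

Section FreeCenter.
Variables (F : groupType) (B : set F) (b0 b1 : F).
Hypotheses (FB : free_on B) (Bb0 : B b0) (Bb1 : B b1) (b01 : b0 <> b1).

(** Sending every generator to the translation by 1 shows that b1 has infinite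
order. *)
Lemma free_gen_order : injective (fun k => b1 ^+ k).
Proof.
pose sh : bij int := Bij (addrK 1%R) (subrK 1%R).
have [phi phiB] := FB.1 _ (fun _ : F => sh).
suff E k : phi (b1 ^+ k) 0%R = Posz k.
  by move=> k l /= /(congr1 (fun x => phi x 0%R)); rewrite !E => -[].
elim: k => [|k IHk]; first by rewrite expg0 hom1.
by rewrite expgS gmulfM phiB // bijME IHk /= -addn1 PoszD.
Qed.

Lemma affK (x : F) (c : F -> bool) :
  cancel (fun u g => u (x^-1 * g) (+) c g) (fun u g => u (x * g) (+) c (x * g)).
Proof. by move=> u; apply: funext => g; rewrite mulKg addbK. Qed.

Lemma affVK (x : F) (c : F -> bool) :
  cancel (fun u g => u (x * g) (+) c (x * g)) (fun u g => u (x^-1 * g) (+) c g).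
Proof. by move=> u; apply: funext => g; rewrite mulVKg addbK. Qed.

Definition aff (x : F) (c : F -> bool) : bij (F -> bool) :=
  Bij (affK x c) (affVK x c).

(** F acts on the functions u : F -> bool by x . u = (translate of u) + c x,
where the cocycle c vanishes on B except that c b0 is the indicator function of
1; its values have finite support. If z is central, then c z is invariant under
b1, which has infinite order, so c z = 0; comparing the actions of z b0 and
b0 z then shows that z translates c b0 to itself. *)
Lemma free_center_trivial (z : F) : gcenter F z -> z = 1.
Proof.
move=> zC.
pose d (x g : F) := `[<x = b0>] && `[<g = 1>].
have [phi phiB] := FB.1 _ (fun x => aff x (d x)).
pose K := [set x | exists2 c : F -> bool,
  (forall u, phi x u = aff x c u) & finite_set [set g | c g]].
have KT x : K x.
  apply: (free_gen FB) => [|y By]; last first.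
    exists (d y) => [u|]; first by rewrite phiB.
    by apply: (sub_finite_set _ (finite_set1 1)) => g /= /andP[_ /asboolP].
  split=> [|y w [c cE cF] [e eE eF]].
    exists (fun=> false) => [u|].
      by rewrite hom1; apply: funext => g /=; rewrite addbF invg1 mul1g.
    by rewrite (_ : [set _ | _] = set0) //; apply/seteqP; split.
  exists (fun g => e (w * y^-1 * g) (+) c g) => [u|].
    have <- : aff w e (bij_inv (aff w e) u) = u by exact: bij_invK.
    rewrite -eE -bijME -gmulfM mulgVK cE eE; apply: funext => g /=.
    by rewrite invgM invgK !mulVKg !mulgA addbA addbK.
  apply: (@sub_finite_set _ _ ([set g | e (w * y^-1 * g)] `|` [set g | c g])).
    by move=> g /=; case: (e _) => [|/= ->]; [left|right].
  rewrite finite_setU; split=> //.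
  apply: (@finite_preimage F F [set g | e g] (fun g => w * y^-1 * g)) eF.
  by move=> g h _ _; apply: mulgI.
have [c cE cF] := KT z.
pose o : F -> bool := fun=> false.
have zb b u : phi z (phi b u) = phi b (phi z u).
  by rewrite -!bijME -!gmulfM (zC b).
have b1o : phi b1 o = o.
  rewrite phiB //; apply: funext => g /=; rewrite /d.
  by rewrite (asboolF (nesym b01)).
have b0o : phi b0 o = fun g => `[<g = 1>].
  by rewrite phiB //; apply: funext => g /=; rewrite /d asboolT.
have zo : phi z o = c by rewrite cE; apply: funext.
have c_inv k g : c g -> c (b1^-1 ^+ k * g).
  move=> cg; elim: k => [|k]; first by rewrite expg0 mul1g.
  move: (zb b1 o); rewrite b1o zo phiB //.
  move=> /(congr1 (fun u => u (b1^-1 ^+ k * g))).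
  by rewrite /= /d (asboolF (nesym b01)) addbF /= mulgA -expgS => <-.
have c0 : c = o.
  apply: funext => g; apply/negbTE/negP => cg.
  apply: infinite_nat.
  have -> : setT = (fun k => b1^-1 ^+ k * g) @^-1` [set g | c g].
    by apply/seteqP; split=> // k _; apply: c_inv.
  apply: finite_preimage => // k l _ _ /mulIg; rewrite !expVgn => /invg_inj.
  exact: free_gen_order.
move: (zb b0 o); rewrite zo c0 b0o cE c0 => /(congr1 (fun u => u z)).
by rewrite /= mulVg asboolT // => /esym/asboolP.
Qed.
End FreeCenter.

Local Open Scope ring_scope.

(** * Lie rings *)

Section LieRingTheory.
Variable L : lieRingType.
Implicit Types a b c : L.

Lemma lie0r a : lie 0 a = 0.
Proof. by apply: (addrI (lie 0 a)); rewrite -lieDl !addr0. Qed.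

Lemma lier0 a : lie a 0 = 0.
Proof. by apply: (addrI (lie a 0)); rewrite -lieDr !addr0. Qed.

Lemma lieNr a b : lie (- a) b = - lie a b.
Proof. by apply: (addrI (lie a b)); rewrite -lieDl !subrr lie0r. Qed.

Lemma lierN a b : lie a (- b) = - lie a b.
Proof. by apply: (addrI (lie a b)); rewrite -lieDr !subrr lier0. Qed.

Lemma lieC a b : lie a b = - lie b a.
Proof.
apply/eqP; rewrite -addr_eq0; have := liexx (a + b).
by rewrite lieDl !lieDr !liexx add0r addr0 => /eqP.
Qed.

Lemma lieMzl a b n : lie (a *~ n) b = lie a b *~ n.
Proof.
have lieMn m : lie (a *+ m) b = lie a b *+ m.
  by elim: m => [|m IHm]; rewrite ?lie0r // !mulrS lieDl IHm.
by case: n => n; rewrite /intmul ?lieNr lieMn.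
Qed.

Lemma lieMzr a b n : lie a (b *~ n) = lie a b *~ n.
Proof. by rewrite lieC lieMzl lieC -mulNrz opprK. Qed.

Lemma lie_derivation a b c :
  lie a (lie b c) = lie (lie a b) c + lie b (lie a c).
Proof.
have /eqP := lie_Jacobi a b c.
rewrite (lieC (lie b c)) (lieC (lie c a)) (lieC c a) lierN opprK.
by rewrite addrAC subr_eq0 => /eqP ->.
Qed.

End LieRingTheory.

(** * The Lie ring of additive endomorphisms *)

Section Endomorphisms.
Variable V : zmodType.

Record endo := Endo {
  endo_fun :> V -> V;
  endoD : {morph endo_fun : x y / x + y} }.

Lemma endoP (f g : endo) : f =1 g -> f = g.
Proof.
case: f g => [f fD] [g gD] /= fg; have fgE : f = g by apply: funext.
by subst g; congr Endo; apply: Prop_irrelevance.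
Qed.

HB.instance Definition _ := gen_eqMixin endo.
HB.instance Definition _ := gen_choiceMixin endo.

Lemma endo0 (f : endo) : f 0 = 0.
Proof. by apply: (addrI (f 0)); rewrite -endoD !addr0. Qed.

Lemma endoN (f : endo) x : f (- x) = - f x.
Proof. by apply: (addrI (f x)); rewrite -endoD !subrr endo0. Qed.

Lemma endoB (f : endo) x y : f (x - y) = f x - f y.
Proof. by rewrite endoD endoN. Qed.

Lemma endo_zero_subproof :
  {morph (fun=> 0) : x y / (x + y : V) >-> (x + y : V)}.
Proof. by move=> x y; rewrite addr0. Qed.
Definition endo_zero := Endo endo_zero_subproof.

Lemma endo_add_subproof (f g : endo) :
  {morph (fun x => f x + g x) : x y / x + y}.
Proof. by move=> x y; rewrite !endoD addrACA. Qed.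
Definition endo_add f g := Endo (endo_add_subproof f g).

Lemma endo_opp_subproof (f : endo) : {morph (fun x => - f x) : x y / x + y}.
Proof. by move=> x y; rewrite endoD opprD. Qed.
Definition endo_opp f := Endo (endo_opp_subproof f).

Lemma endo_addA : associative endo_add.
Proof. by move=> f g h; apply: endoP => x /=; rewrite addrA. Qed.
Lemma endo_addC : commutative endo_add.
Proof. by move=> f g; apply: endoP => x /=; rewrite addrC. Qed.
Lemma endo_add0 : left_id endo_zero endo_add.
Proof. by move=> f; apply: endoP => x /=; rewrite add0r. Qed.
Lemma endo_addN : left_inverse endo_zero endo_opp endo_add.
Proof. by move=> f; apply: endoP => x /=; rewrite addNr. Qed.

HB.instance Definition _ := GRing.isZmodule.Build endo
  endo_addA endo_addC endo_add0 endo_addN.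

Lemma endo_lie_subproof (f g : endo) :
  {morph (fun x => f (g x) - g (f x)) : x y / x + y}.
Proof. by move=> x y; rewrite !endoD opprD addrACA. Qed.
Definition endo_lie f g := Endo (endo_lie_subproof f g).

Lemma endo_lieDl : left_distributive endo_lie +%R.
Proof. by move=> f g h; apply: endoP => x /=; rewrite !endoD opprD addrACA. Qed.
Lemma endo_lieDr : right_distributive endo_lie +%R.
Proof. by move=> f g h; apply: endoP => x /=; rewrite !endoD opprD addrACA. Qed.
Lemma endo_liexx f : endo_lie f f = 0.
Proof. by apply: endoP => x /=; rewrite subrr. Qed.
Lemma endo_lie_Jacobi f g h :
  endo_lie (endo_lie f g) h + endo_lie (endo_lie g h) f
  + endo_lie (endo_lie h f) g = 0.
Proof.
apply: endoP => x /=; rewrite !endoB.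
(* Each of the six compositions of f, g and h occurs with both signs. *)
rewrite !opprB !addrA [LHS](ACl (1*8*2*11*3*6*4*9*5*12*7*10)) /=.
by rewrite !(subrr, addNr, add0r).
Qed.

HB.instance Definition _ := isLieRing.Build endo endo_lieDl endo_lieDr
  endo_liexx endo_lie_Jacobi.

Lemma endo_lieE (f g : endo) x : lie f g x = f (g x) - g (f x).
Proof. by []. Qed.

Lemma endo_addE (f g : endo) x : (f + g) x = f x + g x.
Proof. by []. Qed.

Lemma endo_mulzE (f : endo) n x : (f *~ n) x = f x *~ n.
Proof.
have mulnE m : (f *+ m) x = f x *+ m.
  by elim: m => [|m IHm] //; rewrite !mulrS endo_addE IHm.
by case: n => n; rewrite /intmul -?mulnE.
Qed.

End Endomorphisms.

(** * Lie polynomials with integer coefficients *)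

Inductive lexp (X : Type) :=
  | Lzero
  | Lvar of X
  | Ladd of lexp X & lexp X
  | Lscale of int & lexp X
  | Lbr of lexp X & lexp X.
Arguments Lzero {X}.

Fixpoint lev (X : Type) (L : lieRingType) (eta : X -> L) (e : lexp X) : L :=
  match e with
  | Lzero => 0
  | Lvar x => eta x
  | Ladd e f => lev eta e + lev eta f
  | Lscale n e => lev eta e *~ n
  | Lbr e f => lie (lev eta e) (lev eta f)
  end.

Fixpoint homog (X : Type) (w : X -> nat) (m : nat) (e : lexp X) : Prop :=
  match e with
  | Lzero => True
  | Lvar x => w x = m
  | Ladd e f => homog w m e /\ homog w m f
  | Lscale n e => n = 0 \/ homog w m e
  | Lbr e f => exists i j, [/\ (i + j)%N = m, homog w i e & homog w j f]
  end.

Fixpoint lvars (X : Type) (e : lexp X) : seq X :=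
  match e with
  | Lzero => [::]
  | Lvar x => [:: x]
  | Ladd e f => lvars e ++ lvars f
  | Lscale _ e => lvars e
  | Lbr e f => lvars e ++ lvars f
  end.

Lemma eq_lev (X : eqType) (L : lieRingType) (eta eta' : X -> L) e :
  {in lvars e, eta =1 eta'} -> lev eta e = lev eta' e.
Proof.
elim: e => //= [x|e IHe f IHf|n e IHe|e IHe f IHf] E.
- by apply: E; rewrite inE.
- by rewrite IHe ?IHf // => x xe; apply: E; rewrite mem_cat xe ?orbT.
- by rewrite IHe.
- by rewrite IHe ?IHf // => x xe; apply: E; rewrite mem_cat xe ?orbT.
Qed.

Lemma lev_homog_low (X : eqType) (L : lieRingType) (eta : X -> L) w m d e :
  homog w m e -> (m < d)%N -> {in lvars e, forall x, d <= w x}%N ->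
  lev eta e = 0.
Proof.
elim: e m => //= [x m <- + wd|e IHe f IHf m [he hf] md wd|n e IHe m|
  e IHe f IHf m [i [j [<- he hf]]] md wd].
- by rewrite ltnNge wd // inE.
- have we : {in lvars e, forall x, d <= w x}%N.
    by move=> x xe; apply: wd; rewrite mem_cat xe.
  have wf : {in lvars f, forall x, d <= w x}%N.
    by move=> x xe; apply: wd; rewrite mem_cat xe orbT.
  by rewrite (IHe m) // (IHf m) // addr0.
- by case=> [-> //|he] md wd; rewrite (IHe m) // mul0rz.
- rewrite (IHe i) ?lie0r //; first by apply: leq_ltn_trans md; apply: leq_addr.
  by move=> x xe; apply: wd; rewrite mem_cat xe.
Qed.

(** * Lazard elimination *)

(** The variable (x, k) stands for ad(a)^k x. *)
Section Elimination.
Variables (X : eqType) (a : X).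

(** The derivation ad a, which is a substitution on the new variables. *)
Fixpoint Lder (e : lexp (X * nat)) : lexp (X * nat) :=
  match e with
  | Lzero => Lzero
  | Lvar v => Lvar (v.1, v.2.+1)
  | Ladd e f => Ladd (Lder e) (Lder f)
  | Lscale n e => Lscale n (Lder e)
  | Lbr e f => Ladd (Lbr (Lder e) f) (Lbr e (Lder f))
  end.

(** The two components are the coefficient of a and a Lie polynomial in the
variables (x, k) with x <> a; the brackets with a that come from the first
component are absorbed by Lder. *)
Fixpoint Lelim (e : lexp X) : int * lexp (X * nat) :=
  match e with
  | Lzero => (0, Lzero)
  | Lvar x => if x == a then (1, Lzero) else (0, Lvar (x, 0%N))
  | Ladd e f =>
      ((Lelim e).1 + (Lelim f).1, Ladd (Lelim e).2 (Lelim f).2)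
  | Lscale n e => ((Lelim e).1 * n, Lscale n (Lelim e).2)
  | Lbr e f =>
      (0, Ladd (Ladd (Lscale (Lelim e).1 (Lder (Lelim f).2))
                     (Lscale (- (Lelim f).1) (Lder (Lelim e).2)))
               (Lbr (Lelim e).2 (Lelim f).2))
  end.

Section Evaluation.
Variables (L : lieRingType) (eta : X -> L).

Definition iter_ad (v : X * nat) : L := iter v.2 (lie (eta a)) (eta v.1).

Lemma lev_Lder e : lev iter_ad (Lder e) = lie (eta a) (lev iter_ad e).
Proof.
elim: e => //= [|e -> f ->|n e ->|e -> f ->].
- by rewrite lier0.
- by rewrite lieDr.
- by rewrite lieMzr.
- by rewrite [RHS]lie_derivation.
Qed.

Lemma lev_Lelim e :
  lev eta e = eta a *~ (Lelim e).1 + lev iter_ad (Lelim e).2.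
Proof.
elim: e => /= [|x|e -> f ->|n e ->|e -> f ->].
- by rewrite mulr0z addr0.
- by case: eqP => [->|_] /=; rewrite ?mulr1z ?mulr0z ?addr0 ?add0r.
- by rewrite mulrzDr addrACA.
- by rewrite mulrzDl -mulrzA.
rewrite mulr0z add0r !lev_Lder lieDl !lieDr !lieMzl !lieMzr liexx !mul0rz.
by rewrite add0r addrA [lie _ (eta a)]lieC mulNrz mulrNz.
Qed.

End Evaluation.

Section Weights.
Variable w : X -> nat.

Definition elim_wt (v : X * nat) : nat := (w v.1 + v.2 * w a)%N.

Lemma homog_Lder m e : homog elim_wt m e -> homog elim_wt (w a + m) (Lder e).
Proof.
elim: e m => //= [[x k] m|e IHe f IHf m [he hf]|n e IHe m|e IHe f IHf m].
- by rewrite /elim_wt /= => <-; rewrite mulSn addnCA.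
- by split; [apply: IHe|apply: IHf].
- by case=> [|he]; [left|right; apply: IHe].
- case=> i [j [<- he hf]]; split.
    by exists (w a + i)%N, j; rewrite addnA; split=> //; apply: IHe.
  by exists i, (w a + j)%N; rewrite addnCA; split=> //; apply: IHf.
Qed.

Lemma homog_Lelim m e : homog w m e ->
  ((Lelim e).1 != 0 -> w a = m) /\ homog elim_wt m (Lelim e).2.
Proof.
elim: e m => //= [x m xm|e IHe f IHf m [he hf]|n e IHe m|e IHe f IHf m].
- case: (x =P a) => [<-|_] /=; split=> //.
  by rewrite /elim_wt /= mul0n addn0.
- have [[we he'] [wf hf']] := (IHe _ he, IHf _ hf); split=> //.
  by case: ((Lelim e).1 =P 0) => [->|/eqP/we //]; rewrite add0r.
- case=> [->|he]; first by rewrite mulr0; split; [|left].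
  have [we he'] := IHe _ he; split; last by right.
  by move=> n0; apply: we; apply: contraNneq n0 => ->; rewrite mul0r.
case=> i [j [<- he hf]]; have [[we he'] [wf hf']] := (IHe _ he, IHf _ hf).
split=> //; split; last by exists i, j.
split.
  case: ((Lelim e).1 =P 0) => [|/eqP/we <-]; [by left|right].
  exact: homog_Lder.
case: ((Lelim f).1 =P 0) => [->|/eqP/wf <-]; [by left|right].
by rewrite addnC; apply: homog_Lder.
Qed.

End Weights.

Lemma lvars_Lder e v : v \in lvars (Lder e) -> v.1 \in map fst (lvars e).
Proof.
elim: e => //= [u|e IHe f IHf|e IHe f IHf].
- by rewrite !inE => /eqP ->.
- by rewrite map_cat !mem_cat => /orP[/IHe ->|/IHf ->]; rewrite ?orbT.
- rewrite map_cat !mem_cat -!orbA => /or4P[/IHe ->|vf|ve|/IHf ->];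
  by rewrite ?(map_f _ vf) ?(map_f _ ve) ?orbT.
Qed.

Lemma lvars_Lelim e v :
  v \in lvars (Lelim e).2 -> (v.1 \in lvars e) && (v.1 != a).
Proof.
elim: e v => //= [x|e IHe f IHf|e IHe f IHf] v.
- by case: (x =P a) => //= /eqP xa; rewrite !inE => /eqP -> /=; rewrite eqxx.
- by rewrite !mem_cat => /orP[/IHe|/IHf] /andP[-> ->]; rewrite ?orbT.
- have mapP' g : v.1 \in map fst (lvars (Lelim g).2) ->
      exists2 u, u \in lvars (Lelim g).2 & v.1 = u.1 by move=> /mapP.
  rewrite !mem_cat => /orP[/orP[/lvars_Lder/mapP'|/lvars_Lder/mapP']|/orP[]].
  + by case=> u /IHf /andP[uf ua] ->; rewrite uf ua orbT.
  + by case=> u /IHe /andP[ue ua] ->; rewrite ue ua.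
  + by move=> /IHe /andP[-> ->].
  + by move=> /IHf /andP[-> ->]; rewrite orbT.
Qed.

End Elimination.

(** * Witt's theorem *)

(** This amounts to e being 0 in the free associative ring. In this form one can
pass from a module to a larger one that is adapted to e. *)
Definition vanishes (X : Type) (e : lexp X) : Prop :=
  forall (V : zmodType) (rho : X -> endo V), lev rho e = 0.

Lemma fct_mulzE (T : Type) (V : zmodType) (u : T -> V) n x :
  (u *~ n) x = u x *~ n.
Proof.
have mulnE m : (u *+ m) x = u x *+ m.
  by elim: m => [|m IHm] //; rewrite !mulrS -IHm.
by case: n => n; rewrite /intmul -?mulnE.
Qed.

Section Hurwitz.
Variable V : zmodType.
Implicit Types (c : nat -> endo V) (f : nat -> V).

Definition tail (T : Type) (f : nat -> T) : nat -> T := fun n => f n.+1.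

Lemma tailD : {morph @tail V : f g / f + g}.
Proof. by []. Qed.
Definition shift : endo (nat -> V) := Endo tailD.

(** The product of c and f as Hurwitz series, that is, the binomial
convolution, in the form that makes the shift a derivation by definition. *)
Fixpoint hprod n c f : V :=
  if n is n'.+1 then hprod n' (tail c) f + hprod n' c (tail f)
  else c 0%N (f 0%N).

Lemma hprodD n c f g : hprod n c (f + g) = hprod n c f + hprod n c g.
Proof.
elim: n c f g => [|n IHn] c f g /=; first by rewrite endoD.
by rewrite tailD !IHn addrACA.
Qed.

Lemma hmul_subproof c : {morph (fun f n => hprod n c f) : f g / f + g}.
Proof. by move=> f g; apply: funext => n; apply: hprodD. Qed.
Definition hmul c : endo (nat -> V) := Endo (hmul_subproof c).

Lemma lie_shift_hmul c : lie shift (hmul c) = hmul (tail c).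
Proof.
apply: endoP => f; rewrite endo_lieE; apply: funext => n.
by rewrite -[LHS]/(_ + _ - _) addrK.
Qed.

End Hurwitz.

(** The coefficient of a is read off by letting a act on the integers as the
identity and the other variables as 0. Endomorphisms rho (x, k) of V are the
constant terms of the Hurwitz series that ad(a)^k x becomes when a acts by the
shift and x by the series of coefficients rho (x, l), for all l. *)
Lemma vanishes_Lelim (X : eqType) (a : X) e : vanishes e ->
  (Lelim a e).1 = 0 /\ vanishes (Lelim a e).2.
Proof.
move=> e0.
have n0 : (Lelim a e).1 = 0.
  pose i1 : endo int := @Endo _ id (fun _ _ => erefl).
  have := e0 _ (fun x => if x == a then i1 else 0).
  rewrite (lev_Lelim a) eqxx (@eq_lev _ _ _ (fun=> 0)) => [|v].
    set z := lev _ _; have -> : z = 0.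
      rewrite /z; elim: (Lelim a e).2 => //= [f -> g -> | n f -> | f -> g ->].
      - by rewrite addr0.
      - by rewrite mul0rz.
      - by rewrite lie0r.
    move=> /(congr1 (fun f : endo int => f 1)).
    by rewrite addr0 endo_mulzE /= => <-; rewrite -mulrzr mul1r intz.
  move=> /lvars_Lelim/andP[_ /negbTE va]; rewrite /iter_ad va.
  by elim: v.2 => //= k ->; rewrite lier0.
split=> // V rho.
pose eta x := if x == a then shift V else hmul (fun k => rho (x, k)).
have := e0 _ eta; rewrite (lev_Lelim a) n0 mulr0z add0r => {e0}.
rewrite (@eq_lev _ _ _ (fun v => hmul (fun k => rho (v.1, v.2 + k)%N)))
  => [e0|[x k]]; last first.
  move=> /lvars_Lelim/andP[_ /= /negbTE xa]; rewrite /iter_ad /= /eta eqxx xa.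
  elim: k => //= k ->; rewrite lie_shift_hmul; congr hmul; apply: funext => l.
  by rewrite /tail addnS.
have E f : lev rho (Lelim a e).2 (f 0%N)
    = lev (fun v => hmul (fun k => rho (v.1, v.2 + k)%N)) (Lelim a e).2 f 0%N.
  elim: (Lelim a e).2 f => //= [[x k]|g IHg h IHh|n g IHg|g IHg h IHh] f.
  - by rewrite addn0.
  - by rewrite IHg IHh.
  - by rewrite !endo_mulzE IHg fct_mulzE.
  - by rewrite !(IHg, IHh).
by apply: endoP => v; rewrite (E (fun=> v)) e0.
Qed.

(** The variables of least weight d are eliminated one by one; l lists those
that remain. Eliminating a leaves fewer variables of weight d, because
ad(a)^k x has weight greater than d for k > 0. Once none is left, d increases,
and a Lie polynomial of degree m in variables of weight greater than m is 0. *)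
Lemma lev_vanishes_fuel k s (X : eqType) (w : X -> nat) m d (l : seq X) e :
  (0 < d)%N -> (m < d + k)%N -> (size l <= s)%N -> homog w m e -> vanishes e ->
  {in lvars e, forall x, (d <= w x)%N && ((w x == d) ==> (x \in l))} ->
  forall (L : lieRingType) (eta : X -> L), lev eta e = 0.
Proof.
elim: k s X w d l e => [|k IHk] s X w d l e d0 md ls he e0 el L eta.
  apply: lev_homog_low he _ _; first by rewrite addn0 in md; exact: md.
  by move=> x /el/andP[].
elim: s X w l e ls he e0 el L eta => [|s IHs] X w l e ls he e0 el L eta.
  apply: (IHk (size (lvars e)) X w d.+1 (lvars e)) => //.
    by rewrite addSnnS.
  move=> x xe; rewrite xe implybT andbT ltn_neqAle eq_sym.
  have /andP[-> /implyP xd] := el x xe; rewrite andbT.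
  apply/negP => /xd; rewrite (size0nil (_ : size l = 0%N)) //.
  by case: (size l) ls.
case: l ls el => [|a l] ls el; first exact: (IHs X w [::]).
have [wa|wa] := eqVneq (w a) d; last first.
  apply: (IHs X w l) => // x xe; have /andP[-> /implyP xd] := el x xe.
  apply/implyP => /eqP wx; have := xd; rewrite wx eqxx inE => /(_ isT).
  by case/orP => // /eqP xa; case/eqP: wa; rewrite -xa.
have [n0 e'0] := vanishes_Lelim a e0; have [_ he'] := homog_Lelim a he.
rewrite (lev_Lelim a) n0 mulr0z add0r.
apply: (IHs _ (elim_wt a w) (map (pair^~ 0%N) l)) he' e'0 _ _ _.
  by rewrite size_map.
move=> [x i] /lvars_Lelim/andP[/= /el/andP[dx /implyP xd] xa].
rewrite /elim_wt /= wa (leq_trans dx) ?leq_addr //=.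
apply/implyP; case: i => [|i]; last first.
  rewrite mulSn addnCA -[X in _ == X]addn0 eqn_add2l addn_eq0.
  by rewrite (gtn_eqF (leq_trans d0 dx)).
rewrite mul0n addn0 => /xd; rewrite inE (negbTE xa) /= => xl.
exact: map_f.
Qed.

(** Witt's theorem: all variables have weight one at the start. *)
Theorem lev_vanishes (X : Type) m (e : lexp X) :
  homog (fun=> 1%N) m e -> vanishes e ->
  forall (L : lieRingType) (eta : X -> L), lev eta e = 0.
Proof.
move=> he e0 L eta.
exact: (@lev_vanishes_fuel m (size (lvars (e : lexp {classic X}))) {classic X}
  (fun=> 1%N) m 1 (lvars e) e).
Qed.

(** * The Magnus representation *)

Section Magnus.
Variable V : zmodType.
Implicit Types (f g : nat -> V) (E : endo V) (T : bij (nat -> V)).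

Definition ord_ge n f := forall i, (i < n)%N -> f i = 0.

(** Sequences are read as formal power series in t with coefficients in V; the
condition reads T = 1 + t^m E modulo t^(m+1). The order n of f is arbitrary so
that T can be applied to the error terms of other operators. *)
Definition leads T m E : Prop :=
  {morph T : f g / f + g} /\
  forall n f, ord_ge n f ->
    ord_ge (n + m) (T f - f) /\ (T f - f) (n + m)%N = E (f n).

Lemma ord_geN n f : ord_ge n f -> ord_ge n (- f).
Proof. by move=> fn i /fn fi; rewrite -[LHS]/(- f i) fi oppr0. Qed.

Lemma ord_geD n f g : ord_ge n f -> ord_ge n g -> ord_ge n (f + g).
Proof. by move=> fn gn i ni; rewrite -[LHS]/(f i + g i) fn // gn // addr0. Qed.

Lemma leads_ord T m E n f : (0 < m)%N -> leads T m E -> ord_ge n f ->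
  ord_ge n (T f) /\ T f n = f n.
Proof.
move=> m0 [_ TE] fn; have [Tf _] := TE n f fn.
have E0 i : (i < n + m)%N -> T f i = f i.
  by move=> /Tf /eqP; rewrite -[_ i]/(T f i - f i) subr_eq0 => /eqP.
split=> [i ni|]; last by rewrite E0 // -{1}[n]addn0 ltn_add2l.
by rewrite E0 ?fn // ltn_addr.
Qed.

Lemma leads_additive_inv T : {morph T : f g / f + g} ->
  {morph T^-1%g : f g / f + g}.
Proof.
move=> TD f g; rewrite -{1}[f](bijVK T) -{1}[g](bijVK T).
by rewrite -TD bijKV.
Qed.

Lemma leads1 m : leads 1%g m 0.
Proof.
by split=> // n f fn; split=> [i _|]; rewrite -[LHS]/(f _ - f _) subrr.
Qed.

Lemma leadsM T T' m E E' : (0 < m)%N -> leads T m E -> leads T' m E' ->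
  leads (T * T')%g m (E + E').
Proof.
move=> m0 TE TE'; split=> [f g|n f fn]; first by rewrite /= TE'.1 TE.1.
have [T'n T'f] := leads_ord m0 TE' fn.
have [a b] := TE.2 _ _ T'n; have [c d] := TE'.2 _ _ fn.
have -> : (T * T')%g f - f = (T (T' f) - T' f) + (T' f - f).
  by rewrite addrA subrK.
split; first exact: ord_geD.
by rewrite -[LHS]/(_ (n + m)%N + _ (n + m)%N) b d T'f.
Qed.

Lemma leadsV T m E : (0 < m)%N -> leads T m E -> leads T^-1%g m (- E).
Proof.
move=> m0 TE; split=> [|n f fn]; first exact: leads_additive_inv TE.1.
set g := T^-1%g f; have fE : f = T g by rewrite /g bijVK.
have gn : ord_ge n g.
  suff H k : (k <= n)%N -> ord_ge k g by exact: H.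
  elim: k => // k IHk kn i; rewrite ltnS leq_eqVlt => /predU1P[->|].
    by have [_ <-] := leads_ord m0 TE (IHk (ltnW kn)); rewrite -fE fn.
  exact: IHk (ltnW kn) i.
have [a b] := TE.2 _ _ gn; have [_ c] := leads_ord m0 TE gn.
rewrite fE c -[g - _]opprB; split; first exact: ord_geN.
by rewrite -[LHS]/(- (_ (n + m)%N)) b.
Qed.

(** With T = 1 + P and T' = 1 + Q one has T T' - T' T = P Q - Q P, and dividing
by T' T does not affect the leading term. *)
Lemma leads_gcomm T T' m k E E' : (0 < m)%N -> (0 < k)%N ->
  leads T m E -> leads T' k E' -> leads (gcomm T T') (m + k) (lie E E').
Proof.
move=> m0 k0 TE TE'; have [TV TV'] := (leadsV m0 TE, leadsV k0 TE').
split=> [f g|n f fn]; first by rewrite /gcomm !bijME TV'.1 TV.1 TE'.1 TE.1.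
have [hn hf] := leads_ord k0 TV' fn; have [] := leads_ord m0 TV hn.
set u := (T^-1%g (T'^-1%g f)); rewrite hf => un uf.
have fE : f = T' (T u) by rewrite /u !bijVK.
have -> : gcomm T T' f = T (T' u) by [].
have [gn gE] := TE'.2 _ _ un; have [kn kE] := TE.2 _ _ un.
set g := T' u - u in gn gE; set h := T u - u in kn kE.
have [a b] := TE.2 _ _ gn; have [c d] := TE'.2 _ _ kn.
have gu : T' u = g + u by rewrite subrK.
have hu : T u = h + u by rewrite subrK.
clearbody g h.
have -> : T (T' u) - f = (T g - g) - (T' h - h).
  rewrite fE gu hu TE.1 TE'.1 gu hu.
  by rewrite opprB !opprD !addrA [LHS](ACl (1*5*2*4*3*6)) /= addrK.
have e1 : (n + k + m = n + (m + k))%N by rewrite -addnA [(k + m)%N]addnC.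
have e2 : (n + m + k = n + (m + k))%N by rewrite addnA.
rewrite e1 in a b; rewrite e2 in c d; split.
  exact: ord_geD a (ord_geN c).
by rewrite -[LHS]/(_ (n + (m + k))%N - _ (n + (m + k))%N) b d gE kE uf.
Qed.

(** On a constant sequence, E is the coefficient in degree m of T - 1, which the
second congruence forces to be 0. *)
Lemma leads_uniq T m E E' : leads T m E -> leads T m.+1 E' -> E = 0.
Proof.
move=> [_ TE] [_ TE']; apply: endoP => v.
have f0 : ord_ge 0 (fun=> v) by [].
have [_ <-] := TE _ _ f0; have [a _] := TE' _ _ f0.
by apply: a; rewrite ltn_add2l.
Qed.

Section Generator.
Variable r : endo V.

(** The operator 1 + t r, whose inverse is the geometric series. *)
Definition mag_fun f (n : nat) := f n + (if n is n'.+1 then r (f n') else 0).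

Fixpoint mag_inv f (n : nat) :=
  if n is n'.+1 then f n - r (mag_inv f n') else f 0%N.

Lemma mag_funK : cancel mag_fun mag_inv.
Proof.
move=> f; apply: funext; elim=> [|n IHn] /=; first by rewrite /mag_fun addr0.
by rewrite IHn /mag_fun addrK.
Qed.

Lemma mag_invK : cancel mag_inv mag_fun.
Proof.
by move=> f; apply: funext => -[|n]; rewrite /mag_fun ?addr0 //= subrK.
Qed.

Definition mag : bij (nat -> V) := Bij mag_funK mag_invK.

Lemma leads_mag : leads mag 1 r.
Proof.
have dE f n : (mag f - f) n = if n is n'.+1 then r (f n') else 0.
  by rewrite -[LHS]/(mag_fun f n - f n) /mag_fun addrAC subrr add0r.
split=> [f g|n f fn]; last first.
  rewrite addn1 dE; split=> // -[|i]; rewrite dE // ltnS => /fn ->.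
  exact: endo0.
apply: funext => n; rewrite -[LHS]/(f n + g n + _) -[RHS]/(f n + _ + (g n + _)).
rewrite addrACA; congr (_ + _).
by case: n => [|n]; rewrite ?addr0 // -endoD.
Qed.

End Generator.
End Magnus.

(** * The centre of gr_* of a free group *)

Section FreeGroup.
Variables (F : groupType) (B : set F).
Hypothesis FB : free_on B.

Definition represents m (x : F) (e : lexp F) : Prop :=
  [/\ homog (fun=> 1%N) m e,
      gr_hom m x = lev (fun b => gr_hom 1 b) e
    & forall (V : zmodType) (rho : F -> endo V)
        (phi : {multiplicative F -> bij (nat -> V)}),
        (forall b, B b -> phi b = mag (rho b)) -> leads (phi x) m (lev rho e)].

(** Both the class of x and its leading coefficient turn products into sums and
commutators into brackets, so e can be built along the definition of F_m. *)
Lemma represents_ex m x : (0 < m)%N -> lcs F m x -> exists e, represents m x e.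
Proof.
case: m => // m _.
pose K k := [set x | lcs F k.+1 x /\ exists e, represents k.+1 x e].
have KF k : subgroup (K k).
  split=> [|y z [yL [e [he ye pe]]] [zL [f [hf zf pf]]]].
    split; first exact: lcs1.
    exists Lzero; split=> // [|V rho phi _].
      by apply: gr_hom0; apply: lcs1.
    by rewrite hom1; apply: leads1.
  split; first exact: lcsF.
  exists (Ladd e (Lscale (-1) f)); split=> [|/=|V rho phi phiB /=].
  - by split=> //; right.
  - rewrite gr_homM //; last exact: lcsV.
    rewrite ye mulrN1z -zf; congr (_ + _).
    apply/eqP; rewrite -addr_eq0 -gr_homM //; last exact: lcsV.
    by rewrite mulVg gr_hom0 //; apply: lcs1.
  rewrite gmulfM homV mulrN1z.
  by apply: leadsM (leadsV _ _) => //; [exact: pe|exact: pf].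
have K0 y : K 0%N y.
  apply: (free_gen FB (KF 0%N)) => b Bb; split; first exact: lcs1T.
  exists (Lvar b); split=> // V rho phi phiB /=.
  by rewrite phiB //; apply: leads_mag.
suff KL k : lcs F k.+1 `<=` K k by move=> /KL[].
elim: k => [|k IHk]; first by move=> y _; apply: K0.
apply: smallest_sub => // _ [u uL [v _ <-]].
have [{}uL [e [he ue pe]]] := IHk u uL; have [vL [f [hf vf pf]]] := K0 v.
split; first exact: gcommS.
exists (Lbr e f); split=> /=.
- by exists k.+1, 1%N; rewrite addn1.
- by rewrite -ue -vf -[RHS]/(gr_star_lie _ _) gr_hom_lie // addn1.
move=> V rho phi phiB; rewrite hom_gcomm -addn1.
by apply: leads_gcomm => //; [exact: pe|exact: pf].
Qed.

Variables (b0 b1 : F).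
Hypotheses (Bb0 : B b0) (Bb1 : B b1) (b01 : b0 <> b1).

Section Doubling.
Variables (V : zmodType) (rho : F -> endo V).

(** The first factor carries rho, perturbed at b1 by the shift. *)
Definition double_fun (x : F) (u : (nat -> V) * (nat -> V)) :
    (nat -> V) * (nat -> V) :=
  (fun n => rho x (u.1 n) + (if `[<x = b1>] then u.1 n.+1 else 0),
   if `[<x = b0>] then u.1 else 0).

Lemma double_subproof x : {morph double_fun x : u v / u + v}.
Proof.
move=> [u u'] [v v']; rewrite /double_fun /=; congr pair.
  apply: funext => n; rewrite -[(u + v) n]/(u n + v n) endoD.
  rewrite -[(u + v) n.+1]/(u n.+1 + v n.+1) -[RHS]/(_ + _ + (_ + _)) addrACA.
  by congr (_ + _); case: asboolP; rewrite ?addr0.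
by case: asboolP; rewrite ?addr0.
Qed.

Definition double x : endo ((nat -> V) * (nat -> V))%type :=
  Endo (double_subproof x).

Definition const_term (v : V) : nat -> V := fun n => if n is 0%N then v else 0.

(** The shift kills constant series, so the perturbation is not felt on them. *)
Lemma lev_double_fst e u v : u.1 = const_term v ->
  (lev double e u).1 = const_term (lev rho e v).
Proof.
elim: e u v => /= [|x|e IHe f IHf|n e IHe|e IHe f IHf] u v uv.
- by apply: funext => -[].
- rewrite uv; apply: funext => -[|n] /=; rewrite ?endo0.
    by case: asboolP; rewrite addr0.
  by case: asboolP; rewrite addr0.
- rewrite (IHe _ _ uv) (IHf _ _ uv).
  by apply: funext => -[|n] //; apply: addr0.
- rewrite !endo_mulzE.
  have -> (y : (nat -> V) * (nat -> V)) : (y *~ n).1 = y.1 *~ n.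
    by rewrite raddfMz.
  by rewrite (IHe _ _ uv); apply: funext => -[|k]; rewrite fct_mulzE //= mul0rz.
- rewrite (IHe _ _ (IHf _ _ uv)) (IHf _ _ (IHe _ _ uv)).
  by apply: funext => -[|n] //; apply: subr0.
Qed.

Lemma lev_double_snd e w : lev double e (0, w) = 0.
Proof.
elim: e w => /= [|x|e IHe f IHf|n e IHe|e IHe f IHf] w.
- by [].
- rewrite /double_fun /=; congr pair; last by case: asboolP.
  apply: funext => n; rewrite -[(0 : nat -> V) n]/(0 : V) endo0 add0r.
  by case: asboolP.
- by rewrite IHe IHf addr0.
- by rewrite endo_mulzE IHe mul0rz.
- by rewrite IHe IHf !endo0 subr0.
Qed.

End Doubling.

(** In the doubled module b1 acts on the first factor by rho b1 + shift, which
is onto, and maps to 0 in the second factor; b0 copies the first factor to the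
second. Commuting with b1 forces the second component of e to vanish, and
commuting with b0 then forces the first one to vanish. *)
Lemma vanishes_commuting (e : lexp F) :
  (forall (V : zmodType) (rho : F -> endo V) b,
     B b -> lie (lev rho e) (rho b) = 0) ->
  vanishes e.
Proof.
move=> eC V rho; apply: endoP => v.
pose E := lev (double rho) e.
have EC b u : B b -> E (double rho b u) = double rho b (E u).
  move=> Bb; apply/eqP; rewrite -subr_eq0.
  by rewrite -endo_lieE eC.
have E2 u : (E u).2 = 0.
  case: u => x y.
  (* rho b1 + shift is onto: z is a preimage of x. *)
  pose z := fix z n := if n is n'.+1 then x n' - rho b1 (z n') else 0.
  have -> : (x, y) = double rho b1 (z, 0) + (0, y).
    rewrite /= /double_fun /= asboolT // (asboolF (nesym b01)).
    congr pair; last by rewrite add0r.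
    by apply: funext => n; rewrite -[RHS]/(_ + _ + 0) addr0 addrC subrK.
  rewrite endoD lev_double_snd addr0 EC //= /double_fun.
  by rewrite (asboolF (nesym b01)).
have := congr1 snd (EC b0 (const_term v, 0) Bb0).
rewrite E2 /= asboolT // (@lev_double_fst _ rho e _ v) //.
by move=> /(congr1 (@^~ 0%N)) /= <-.
Qed.

(** Since [x, b] lies in F_(m+2), its coefficient in degree m+1, which is the
bracket of the leading coefficients of x and b, vanishes in every Magnus
representation. *)
Theorem free_gr_center m x : (0 < m)%N -> lcs F m x ->
  (forall y, lcs F m.+2 (gcomm x y)) -> lcs F m.+1 x.
Proof.
move=> m0 xL xC; have [e [he xe pe]] := represents_ex m0 xL.
suff /(lev_vanishes he) e0 : vanishes e.
  apply/gr_class_eq0 => //; move: xe; rewrite e0.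
  by move=> /(congr1 (fun a : gr_star F => a m)); rewrite /= eqxx.
apply: vanishes_commuting => V rho b Bb.
have [phi phiB] := FB.1 _ (fun b => mag (rho b)).
have := leads_gcomm m0 (isT : (0 < 1)%N) (pe _ _ _ phiB) (leads_mag (rho b)).
rewrite -phiB // -hom_gcomm addn1.
have [f [_ _ pf]] := represents_ex (isT : (0 < m.+2)%N) (xC b).
by move=> bE; apply: leads_uniq bE (pf _ _ _ phiB).
Qed.

End FreeGroup.

Local Close Scope ring_scope.

(** * Trivial action on homology *)

Section Abelianization.
Local Open Scope ring_scope.
Variable A : groupType.

(** The isomorphism of H_1(A) with the abelianization A_1 / A_2, on chains. *)
Definition ab_tuple (t : 1.-tuple A) : zmodule (gr A 1) := gr_class 1 (thead t).
Definition ab : bar A 1 -> zmodule (gr A 1) := fglift ab_tuple.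

HB.instance Definition _ := GRing.isAdditive.Build
  (bar A 1) (zmodule (gr A 1)) ab (lift_is_additive ab_tuple).

Definition bar_d2 : bar A 2 -> bar A 1 := @bar_d A 1.
Definition face_sum (g : 2.-tuple A) : bar A 1 :=
  \sum_(i < 3) (-1) ^+ i *: << bar_face i g >>.
HB.instance Definition _ := GRing.isAdditive.Build (bar A 2) (bar A 1) bar_d2
  (lift_is_additive face_sum).

Lemma abZ k z : ab (k *: z) = k *: ab z.
Proof. by rewrite -[k in LHS]intz -[k in RHS]intz !scaler_int raddfMz. Qed.

(** The boundary of [x|y] is [y] - [xy] + [x]. *)
Lemma ab_bar_d w : ab (bar_d2 w) = 0.
Proof.
elim/freeg_ind_dom0: w => [|k g D _ _ IH]; first by rewrite !raddf0.
rewrite !raddfD /= IH addr0 /bar_d2 /bar_d liftU abZ.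
rewrite !big_ord_recl big_ord0 addr0 !raddfD /= !abZ /ab !liftU /ab_tuple.
rewrite /thead !tnth_mktuple /=.
set x := tnth g _; set y := tnth g _; rewrite /bump /= expr0 expr1 sqrrN expr1n.
rewrite -!scalerDr !scale1r scaleN1r gr_classM; try exact: lcs1T.
suff E (u v : zmodule (gr A 1)) : u + (- (v + u) + v) = 0 by rewrite E scaler0.
by rewrite opprD addrAC addNr add0r subrr.
Qed.

(** Every 1-chain [x] is a cycle. *)
Lemma homology_trivial_ab (c : {multiplicative A -> A}) x :
  homology_trivial c -> lcs A 2 (c x * x^-1)%g.
Proof.
pose z : bar A 1 := << [tuple x] >>.
move=> /(_ 1%N z) [].
  rewrite /bar_cycle /= /bar_d liftU !big_ord_recl big_ord0.
  rewrite !(tuple0 (bar_face _ _)).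
  by rewrite expr0 expr1 addr0 scaleN1r !scale1r subrr.
move=> w zw; apply/gr_class_eq => //.
have := congr1 ab zw; rewrite [X in _ = X -> _](ab_bar_d w).
rewrite raddfB /= /bar_map liftU scale1r /ab !liftU !scale1r /ab_tuple /=.
by move=> /eqP; rewrite subr_eq0 => /eqP.
Qed.

End Abelianization.

(** An endomorphism that is trivial on the abelianization is trivial on gr_*,
because the class of a commutator depends only on the classes of its entries. *)
Lemma gr_hom_id (A : groupType) (c : {multiplicative A -> A}) :
  (forall x, lcs A 2 (c x * x^-1)) ->
  forall m x, lcs A m x -> lcs A m.+1 (c x * x^-1).
Proof.
move=> c1 [|m] // ; elim: m => [|m IHm] // x xL.
have cL k y : lcs A k y -> lcs A k (c y) by apply: hom_lcs.
suff: lcs A m.+2 `<=` [set x | lcs A m.+2 x /\ lcs A m.+3 (c x * x^-1)].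
  by move=> /(_ x xL) [].
apply: smallest_sub.
  split=> [|u v [uL uE] [vL vE]].
    by split; [exact: lcs1|rewrite hom1 mulgV; exact: lcs1].
  have uvL := lcsF uL vL; split=> //.
  have /(gr_class_eq (cL _ _ uL) uL) {}uE := uE.
  have /(gr_class_eq (cL _ _ vL) vL) {}vE := vE.
  apply/(gr_class_eq (cL _ _ uvL) uvL).
  rewrite gmulfM homV !gr_classM ?gr_classV ?uE ?vE //; try exact: cL.
    exact: lcsV.
  by apply/lcsV/cL.
move=> _ [u uL [v _ <-]]; have {}uL : lcs A m.+1 u by [].
have uvL := gcommS v uL; split=> //.
apply/(gr_class_eq (cL _ _ uvL) uvL); rewrite hom_gcomm.
have E := @gr_lieE A m.+1 1 m.+2 _ _ (addn1 _).
have v1 : lcs A 1 v by [].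
rewrite -(E _ _ uL v1) -(E _ _ (cL _ _ uL) (cL _ _ v1)).
by congr gr_lie; apply/gr_class_eq; rewrite ?addn1 //; [exact: cL|exact: IHm].
Qed.

(** * Lower central series of almost direct products *)

Section AlmostDirect.
Variables (A G B : groupType) (j : {multiplicative A -> G})
  (p : {multiplicative G -> B}) (s : {multiplicative B -> G}).
Hypotheses (j_inj : injective j) (jp : range j = [set g | p g = 1])
  (sK : cancel s p)
  (triv : forall g (c : {multiplicative A -> A}),
     (forall x, j (c x) = g * j x * g^-1) -> forall x, lcs A 2 (c x * x^-1)).

Lemma p_j a : p (j a) = 1.
Proof. by suff: [set g | p g = 1] (j a) by []; rewrite -jp; exists a. Qed.

Lemma ker_p g : p g = 1 -> exists a, g = j a.
Proof.
by move=> pg; have : range j g; [rewrite jp|case=> a _ <-; exists a].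
Qed.

Lemma conj_ex g : exists c : {multiplicative A -> A},
  forall x, j (c x) = g * j x * g^-1.
Proof.
have /choice[c cE] x : exists y, j y = g * j x * g^-1.
  have [|a ->] := @ker_p (g * j x * g^-1); last by exists a.
  by rewrite !gmulfM p_j mulg1 homV mulgV.
have cM : {morph c : x y / x * y}.
  by move=> x y; apply: j_inj; rewrite gmulfM !cE gmulfM !mulgA mulgVK.
by exists (mk_hom cM).
Qed.

Definition jlcs m : set G := j @` lcs A m.

Lemma jlcsF m u v : jlcs m u -> jlcs m v -> jlcs m (u * v^-1).
Proof.
move=> [x xL <-] [y yL <-]; exists (x * y^-1); first exact: lcsF.
by rewrite gmulfM homV.
Qed.

Lemma jlcs1 m : jlcs m 1.
Proof. by exists 1; [exact: lcs1|exact: hom1]. Qed.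

Lemma jlcsV m u : jlcs m u -> jlcs m u^-1.
Proof. by move=> /(jlcsF (jlcs1 m)); rewrite mul1g. Qed.

Lemma jlcsM m u v : jlcs m u -> jlcs m v -> jlcs m (u * v).
Proof. by move=> uL /jlcsV /(jlcsF uL); rewrite invgK. Qed.

Lemma jlcs_le m k : (m <= k)%N -> jlcs k `<=` jlcs m.
Proof. by move=> mk _ [x xL <-]; exists x => //; apply: lcs_le mk _ xL. Qed.

Lemma gcomm_jlcs1 m g u : jlcs m u -> jlcs m.+1 (gcomm g u).
Proof.
move=> [x xL <-]; have [c cE] := conj_ex g.
exists (c x * x^-1); first by apply: gr_hom_id xL; apply: triv cE.
by rewrite gmulfM homV cE.
Qed.

Lemma jlcsJ m g u : jlcs m u -> jlcs m (g * u * g^-1).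
Proof.
move=> uL; have -> : g * u * g^-1 = gcomm g u * u by rewrite /gcomm mulgVK.
by apply: jlcsM => //; apply: jlcs_le (gcomm_jlcs1 g uL).
Qed.

(** The Hall-Witt identity raises the case k = 1 to all k. *)
Lemma gcomm_jlcs k m g u : lcs G k g -> jlcs m u -> jlcs (k + m) (gcomm g u).
Proof.
case: k => [|k]; first by move=> _ /(gcomm_jlcs1 g)/jlcs_le; apply.
elim: k => [|k IHk] in m g u *; first by move=> _; apply: gcomm_jlcs1.
suff KL : lcs G k.+2 `<=`
    [set g | forall m u, jlcs m u -> jlcs (k.+2 + m) (gcomm g u)].
  by move=> /KL; apply.
have KJ i x y : jlcs i x -> jlcs i (y^-1 * x * y).
  by move=> xL; rewrite -{2}[y]invgK; apply: jlcsJ.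
apply: smallest_sub => [|_ [a aL [b _ <-]] {}m v vL /=].
  have KM (x y : G) : (forall m u, jlcs m u -> jlcs (k.+2 + m) (gcomm x u)) ->
      (forall m u, jlcs m u -> jlcs (k.+2 + m) (gcomm y u)) ->
      forall m u, jlcs m u -> jlcs (k.+2 + m) (gcomm (x * y) u).
    move=> Kx Ky i v vL; rewrite gcommMl.
    by apply: jlcsM; [apply: jlcsJ; apply: Ky|apply: Kx].
  split=> [i v vL|x y Kx Ky /=]; first by rewrite gcomm1g; apply: jlcs1.
  apply: KM => // i v vL; rewrite gcommVl.
  by apply/KJ/jlcsV; apply: Ky.
have wL : jlcs m (b^-1 * v * b) by apply: KJ.
move: (Hall_Witt a b (b^-1 * v * b)).
set w := b^-1 * v * b in wL *.
have -> : b * w * b^-1 = v by rewrite /w !mulgA mulgV mul1g mulgK.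
rewrite -mulgA => /(canRL (mulgK _)); rewrite mul1g => ->.
apply/jlcsV/jlcsM.
  rewrite -gcommV; apply: jlcsV; rewrite addSnnS.
  by apply: IHk; [apply: lcsJ|apply: gcomm_jlcs1].
rewrite -gcommV; apply: jlcsV; rewrite addSn; apply: gcomm_jlcs1.
by rewrite -gcommV; apply: jlcsV; apply: IHk.
Qed.

(** The elements g and s (p g) of G_m agree modulo A_m: this is clear for m = 1,
and passes to commutators by gcomm_jlcs. *)
Lemma lcs_retract m g : lcs G m g -> jlcs m (g * (s (p g))^-1).
Proof.
have J1 m1 h : (m1 <= 1)%N -> jlcs m1 (h * (s (p h))^-1).
  move=> m1_le; apply: (jlcs_le m1_le).
  have [|a ->] := @ker_p (h * (s (p h))^-1); last by exists a.
  by rewrite gmulfM homV sK mulgV.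
case: m => [|m]; first by move=> _; apply: J1.
elim: m g => [|m IHm] g; first by move=> _; apply: J1.
suff: lcs G m.+2 `<=` [set g | jlcs m.+2 (g * (s (p g))^-1)] by apply.
apply: smallest_sub => [|_ [u uL [v _ <-]] /=].
  split=> [|x y /= xL yL]; first by rewrite /= !hom1 mulgV; apply: jlcs1.
  rewrite !gmulfM !homV invgM invgK.
  set x' := s _ in xL *; set y' := s _ in yL *.
  have -> : x * y^-1 * (y' * x'^-1) =
      (x * y^-1) * (y * y'^-1)^-1 * (x * y^-1)^-1 * (x * x'^-1).
    by rewrite !invgM !invgK !mulgA !(mulgVK, mulgK).
  by apply: jlcsM => //; apply/jlcsJ/jlcsV.
rewrite !hom_gcomm.
have := IHm u uL; set u' := s (p u); set a := u * u'^-1 => aL.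
have := J1 1%N v isT; set v' := s (p v); set b := v * v'^-1 => bL.
have u'L : lcs G m.+1 u' by apply/hom_lcs/hom_lcs.
have zL : lcs G m.+2 (gcomm u' v') by apply: gcommS.
(* The commutator of u = a u' and v = b v' is [u', v'] up to factors that have
a or b as an entry. *)
pose x := a * gcomm u' v * a^-1.
have -> : gcomm u v * (gcomm u' v')^-1 =
    x * gcomm a v * x^-1 * gcomm a (gcomm u' v) * gcomm u' b
      * gcomm b (gcomm u' v').
  rewrite /x; have -> : u = a * u' by rewrite mulgVK.
  have -> : v = b * v' by rewrite mulgVK.
  move: (a) (b) (u') (v') => a' b' u1 v1.
  by rewrite /gcomm !invgM !invgK !mulgA !(mulgVK, mulgK).
have jC k y z : jlcs k (gcomm y z) -> jlcs k (gcomm z y).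
  by move=> yz; rewrite -gcommV; apply: jlcsV.
apply: jlcsM; last first.
  by apply: jC; apply: jlcs_le (gcomm_jlcs zL bL); rewrite addn1.
apply: jlcsM; last by rewrite -[m.+2]addn1; apply: gcomm_jlcs.
apply: jlcsM; last by apply/jC/gcomm_jlcs1.
by apply/jlcsJ/jC/gcomm_jlcs1.
Qed.

(** The retraction s o p kills A. *)
Lemma lcs_j m a : lcs G m (j a) -> lcs A m a.
Proof.
move=> /lcs_retract; rewrite p_j hom1 invg1 mulg1.
by move=> [b bL /j_inj <-].
Qed.

End AlmostDirect.

(** * Functoriality of the associated graded Lie ring *)

Section GrMap.
Local Open Scope ring_scope.
Variables (G H : groupType) (f : {multiplicative G -> H}).

Definition gr_map m (x : gr G m) : gr H m := gr_class m (f (val (repr x))).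

Lemma gr_mapE m u : lcs G m u -> gr_map (gr_class m u) = gr_class m (f u).
Proof.
move=> uL; apply/gr_class_eq; try by apply: hom_lcs => //; apply: repr_lcs.
by rewrite -homV -gmulfM; apply: hom_lcs; apply: repr_gr_class.
Qed.

Lemma gr_mapD m (x y : gr G m) : gr_map (x + y) = gr_map x + gr_map y.
Proof.
have [u uL ->] := gr_classP x; have [v vL ->] := gr_classP y.
rewrite -gr_classM // !gr_mapE //; last exact: lcsM.
by rewrite gmulfM gr_classM //; apply: hom_lcs.
Qed.

Lemma gr_map0 m : gr_map (0 : gr G m) = 0.
Proof. by apply: (addrI (gr_map 0)); rewrite -gr_mapD !addr0. Qed.

Lemma gr_star_map_subproof (a : gr_star G) :
  exists N, forall m, (N <= m)%N -> gr_map (a m) = 0.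
Proof.
by have [N aN] := gr_coord_finite a; exists N => m /aN ->; apply: gr_map0.
Qed.
Definition gr_star_map a := GrStar (gr_star_map_subproof a).

Lemma gr_star_mapD : {morph gr_star_map : a b / a + b}.
Proof. by move=> a b; apply: gr_starP => m; apply: gr_mapD. Qed.

Lemma gr_star_map0 : gr_star_map 0 = 0.
Proof. by apply: gr_starP => m; apply: gr_map0. Qed.

Lemma gr_star_map_hom m u : lcs G m u ->
  gr_star_map (gr_hom m u) = gr_hom m (f u).
Proof.
move=> uL; apply: gr_starP => k /=.
by case: eqP => [->|_]; [apply: gr_mapE|apply: gr_map0].
Qed.

Lemma gr_star_map_lie a b :
  gr_star_map (lie a b) = lie (gr_star_map a) (gr_star_map b).
Proof.
elim/gr_star_ind: a => [|a i u uL IHa].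
  by rewrite !(lie0r, gr_star_map0).
rewrite lieDl !gr_star_mapD lieDl {}IHa; congr (_ + _).
elim/gr_star_ind: b => [|b k v vL IHb].
  by rewrite !(lier0, gr_star_map0).
rewrite lieDr !gr_star_mapD lieDr {}IHb; congr (_ + _).
rewrite -[lie _ _]/(gr_star_lie _ _) -[RHS]/(gr_star_lie _ _).
rewrite gr_hom_lie // !gr_star_map_hom //; last exact: gcomm_lcs.
by rewrite hom_gcomm gr_hom_lie //; apply: hom_lcs.
Qed.

End GrMap.

Lemma gr_star_mapK (G H : groupType) (f : {multiplicative G -> H})
    (g : {multiplicative H -> G}) :
  cancel g f -> cancel (gr_star_map g) (gr_star_map f).
Proof.
move=> gK a; apply: gr_starP => m /=; have [u uL ->] := gr_classP (a m).
by rewrite !gr_mapE ?gK //; apply: hom_lcs.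
Qed.

(** * Centres *)

Section Centres.
Local Open Scope ring_scope.

(** The centre is homogeneous: the bracket of a with the class of y in degree
one has the bracket of the component of degree m as a component. *)
Lemma lie_center_gcomm (G : groupType) (a : gr_star G) m x y :
  lie_center (gr_star G) a -> lcs G m x -> a m = gr_class m x ->
  lcs G m.+2 (gcomm x y).
Proof.
move=> aC xL ax; apply/gr_class_eq0; first exact: gcommS.
have y1 : lcs G 1 y by [].
have /(congr1 (fun c : gr_star G => c m.+1)) := aC (gr_hom 1 y).
rewrite /= /gr_star_lie_coord /=.
(* Only the summand of index m pairs with degree one. *)
rewrite (bigD1 (widen_ord (leqnSn _) ord_max)) //= big1.
  by rewrite subSnn eqxx ax addr0 (gr_lieE (addn1 m)).
move=> i im; case: eqP => [i1|_]; last first.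
  by apply: gr_lier0; rewrite subnKC // -ltnS.
case/eqP: im; apply: val_inj => /=; apply/eqP.
have := ltn_ord i; rewrite ltnS => ile; rewrite -(eqn_add2r 1).
by rewrite -{1}i1 subnKC // addn1.
Qed.

Lemma free_lie_center (F : groupType) (B : set F) (a : gr_star F) :
  free_on B -> (`I_2 #<= B)%card -> lie_center (gr_star F) a -> a = 0.
Proof.
move=> FB /card_ge2[b0 [b1 [Bb0 Bb1 b01]]] aC; apply: gr_starP => m.
have [x xL ax] := gr_classP (a m); rewrite ax.
case: m => [|m] in x xL ax *; first exact: gr0_trivial.
apply/gr_class_eq0 => //; apply: (free_gr_center FB Bb0 Bb1 b01) => // y.
exact: lie_center_gcomm ax.
Qed.

Section Step.
Variables (A G B : groupType) (j : {multiplicative A -> G})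
  (p : {multiplicative G -> B}) (s : {multiplicative B -> G}) (X : set A).
Hypotheses (j_inj : injective j) (jp : range j = [set g | p g = 1%g])
  (sK : cancel s p)
  (triv : forall g (c : {multiplicative A -> A}),
     (forall x, j (c x) = g * j x * g^-1)%g -> forall x, lcs A 2 (c x * x^-1)%g)
  (FX : free_on X) (X2 : (`I_2 #<= X)%card).

(** The splitting makes gr_*(G) -> gr_*(B) onto. *)
Lemma lie_center_map a : lie_center (gr_star G) a ->
  lie_center (gr_star B) (gr_star_map p a).
Proof.
move=> aC b; rewrite -(gr_star_mapK sK b) -gr_star_map_lie aC.
exact: gr_star_map0.
Qed.

(** A central class that dies in gr_*(B) is represented by an element of A; it
is central in gr_*(A), because A_m is the intersection of A with G_m. *)
Lemma lie_center_map_inj a : lie_center (gr_star G) a ->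
  gr_star_map p a = 0 -> a = 0.
Proof.
move=> aC pa; apply: gr_starP => m.
have [x xL ax] := gr_classP (a m).
case: m => [|m] in x xL ax *; first exact: gr0_trivial.
have px : lcs B m.+2 (p x).
  apply/gr_class_eq0; first exact: hom_lcs.
  by rewrite -gr_mapE // -ax -[LHS]/(gr_star_map p a m.+1) pa.
have spx : lcs G m.+2 (s (p x)) by apply: hom_lcs.
(* Dividing x by s (p x) does not change its class. *)
have [|y yE] := ker_p jp (g := x * (s (p x))^-1).
  by rewrite gmulfM homV sK mulgV.
have jyL : lcs G m.+1 (j y).
  by rewrite -yE; apply: lcsM => //; apply/lcsV/lcs_sub.
have ay : a m.+1 = gr_class m.+1 (j y).
  rewrite ax; apply/gr_class_eq => //; rewrite -yE invgM invgK mulgA.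
  exact: lcsJ.
have yL : lcs A m.+1 y by apply: (lcs_j j_inj jp sK triv).
have [b0 [b1 [Xb0 Xb1 b01]]] := card_ge2 X2.
rewrite ay; apply/gr_class_eq0 => //; apply: hom_lcs.
apply: (free_gr_center FX Xb0 Xb1 b01) => // z.
apply: (lcs_j j_inj jp sK triv); rewrite hom_gcomm.
exact: lie_center_gcomm ay.
Qed.

Lemma gcenter_step : gcenter B = [set 1%g] -> gcenter G = [set 1%g].
Proof.
move=> BC; apply/seteqP; split=> [z zC|_ -> g]; last first.
  by rewrite /commute mul1g mulg1.
have : gcenter B (p z).
  by move=> b; rewrite /commute -(sK b) -!gmulfM (zC (s b)).
rewrite BC => /= /(ker_p jp)[y yE].
have [b0 [b1 [Xb0 Xb1 b01]]] := card_ge2 X2.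
rewrite yE (free_center_trivial FX Xb0 Xb1 b01 (z := y)) ?hom1 // => x.
by apply: j_inj; rewrite !gmulfM -yE; apply: zC.
Qed.

End Step.

Lemma lie_centerB (L : lieRingType) (a b : L) :
  lie_center L a -> lie_center L b -> lie_center L (a - b).
Proof. by move=> aC bC c; rewrite lieDl lieNr aC bC subr0. Qed.

(** A nonzero A is generated by an element whose image is the least positive
multiple of the generator of C, by Euclidean division. *)
Lemma cyclic_preimage (V W : zmodType) (f : V -> W) (A : set V) (C : set W) :
  {morph f : x y / x + y} -> A 0 -> (forall x y, A x -> A y -> A (x - y)) ->
  (forall x, A x -> f x = 0 -> x = 0) -> (forall x, A x -> C (f x)) ->
  cyclic_zmod C -> cyclic_zmod A.
Proof.
move=> fD A0 AB f_inj fC [c Cc cgen].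
have f0 : f 0 = 0 by apply: (addrI (f 0)); rewrite -fD !addr0.
have fN x : f (- x) = - f x by apply: (addrI (f x)); rewrite -fD !subrr.
have fMz x n : f (x *~ n) = f x *~ n.
  have fMn m : f (x *+ m) = f x *+ m.
    by elim: m => [|m IHm] //; rewrite !mulrS fD IHm.
  by case: n => n; rewrite /intmul ?fN fMn.
have AN x : A x -> A (- x) by rewrite -sub0r; apply: AB.
have AMz x n : A x -> A (x *~ n).
  move=> Ax; have AMn m : A (x *+ m).
    elim: m => [|m IHm] //; rewrite mulrSr -[x in X in _ + X]opprK.
    by apply: AB => //; apply: AN.
  by case: n => n; rewrite /intmul; [apply: AMn|apply/AN/AMn].
have [[x Ax x0]|A00] := pselect (exists2 x, A x & x <> 0); last first.
  by exists 0 => // b Ab; exists 0; apply: contrapT => b0; apply: A00; exists b.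
pose P n := (0 < n)%N && `[<exists2 x, A x & f x = c *~ n>].
have : exists n, P n.
  have [n fx] := cgen _ (fC x Ax).
  have n0 : n != 0.
    by apply: contra_notN x0 => /eqP n0; apply: f_inj; rewrite ?fx ?n0.
  exists `|n|%N; rewrite /P absz_gt0 n0; apply/asboolP.
  case: n fx {n0} => n fx; first by exists x.
  by exists (- x); [apply: AN|rewrite fN fx NegzE mulrNz opprK abszN].
case/ex_minnP => n /andP[n0 /asboolP[y Ay fy]] nmin.
exists y => // b Ab; have [m fb] := cgen _ (fC b Ab).
exists (m %/ n)%Z; apply/eqP; rewrite -subr_eq0; apply/eqP.
have bA : A (b - y *~ (m %/ n)%Z) by apply: AB => //; apply: AMz.
have fr : f (b - y *~ (m %/ n)%Z) = c *~ (m %% n)%Z.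
  rewrite fD fN fMz fy fb -mulrzA -mulrzBr {1}(divz_eq m n).
  by rewrite addrC mulrC addKr.
have n0' : n%:Z != 0 by rewrite -lt0n.
apply: f_inj => //; rewrite fr.
have : (0 <= (m %% n)%Z) by apply: modz_ge0.
have : ((m %% n)%Z < n%:Z) by apply: ltz_pmod.
case: (m %% n)%Z fr => // -[//|r] fr rn _.
have : (n <= r.+1)%N.
  by apply: nmin; rewrite /P /=; apply/asboolP; exists (b - y *~ (m %/ n)%Z).
by rewrite leqNgt -ltz_nat rn.
Qed.

(** F is abelian, so gr_*(F) is concentrated in degree one. *)
Lemma free_cyclic_lie_center (F : groupType) (B : set F) :
  free_on B -> ~ (`I_2 #<= B)%card -> cyclic_zmod (lie_center (gr_star F)).
Proof.
move=> FB B2.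
have [b Bb] : exists b, forall x, B x -> x = b.
  have [[b Bb]|B0] := pselect (exists b, B b).
    exists b => x Bx; apply: contrapT => xb; apply: B2.
    exact: card_ge2_intro Bx Bb xb.
  by exists 1%g => x Bx; case: B0; exists x.
have bC x : commute x b.
  apply: (free_gen FB (K := [set x | commute x b])) => [|y /Bb -> //].
  split=> [|u v /= ub vb]; first exact: commute_sym (commute1 _).
  by apply/commute_sym/commuteM; [apply/commute_sym|apply/commuteV/commute_sym].
have FC (x y : F) : commute x y.
  apply: (free_gen FB (K := [set y | commute x y])) => [|z /Bb ->];
    last exact: bC.
  split=> [|u v /= ub vb]; first exact: commute1.
  by apply: commuteM => //; apply: commuteV.
have L2 (y : F) : lcs F 2 y -> y = 1%g.
  suff LS : lcs F 2 `<=` [set 1%g] by move=> /LS.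
  apply: smallest_sub => [|_ [u _ [v _ <-]] /=].
    by split=> // u v -> ->; rewrite mulgV.
  by rewrite /gcomm (FC u v) mulgK mulgV.
have gen x : exists n : int, gr_hom 1 x = gr_hom 1 b *~ n.
  pose K := [set x | exists n : int, gr_hom 1 x = gr_hom 1 b *~ n].
  suff : K x by []; apply: (free_gen FB (K := K)).
    have L1 y : lcs F 1 y by [].
    split=> [|u v [i ui] [k vk]].
      by exists 0; apply: gr_hom0; apply: lcs1.
    exists (i - k); rewrite mulrzBr -ui -vk gr_homM //; congr (_ + _).
    apply/eqP; rewrite -addr_eq0 -gr_homM // mulVg gr_hom0 //.
    exact: lcs1.
  by move=> y /Bb ->; exists 1.
exists (gr_hom 1 b) => [a|a _].
  elim/gr_star_ind: a => [|a i u uL IHa]; first exact: lier0.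
  rewrite lieDr IHa add0r -[lie _ _]/(gr_star_lie _ _) gr_hom_lie //.
  rewrite /gcomm (FC b u) mulgK mulgV gr_hom0 //.
  exact: lcs1.
have [x xL ax] := gr_classP (a 1%N); have [n xn] := gen x; exists n.
rewrite -xn; apply: gr_starP => -[|[|m]] /=; first exact: gr0_trivial.
  by rewrite ax.
have [u uL ->] := gr_classP (a m.+2).
by rewrite (L2 u) //; apply: lcs_le uL.
Qed.

End Centres.

(** * Poly-free groups *)

Local Open Scope card_scope.

Theorem proposition2p1
  (n : nat)
  (Gam : nat -> groupType)
  (N : nat -> groupType)
  (alpha : forall k : nat, set (polyfree_factor Gam N k))
  (j : forall k : nat, {multiplicative N k -> Gam k.+1})
  (p : forall k : nat, {multiplicative Gam k.+1 -> Gam k})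
  (alpha_free : forall k : nat, (k <= n)%N -> free_on (alpha k))
  (alpha_countable : forall k : nat, (0 < k <= n)%N -> countable (alpha k))
  (alpha_ge2 : forall k : nat, (0 < k <= n)%N -> `I_2 #<= alpha k)
  (j_inj : forall k : nat, (k < n)%N -> injective (j k))
  (jp_exact : forall k : nat, (k < n)%N -> range (j k) = [set g | p k g = 1])
  (p_split : forall k : nat, (k < n)%N ->
     exists s : {multiplicative Gam k -> Gam k.+1}, cancel s (p k))
  (action_trivial : forall k : nat, (k < n)%N ->
     forall (g : Gam k.+1) (c : {multiplicative N k -> N k}),
       (forall x : N k, j k (c x) = g * j k x * g^-1) -> homology_trivial c) :
  cyclic_zmod (lie_center (gr_star (Gam n))) /\
  ((forall k : nat, (k <= n)%N -> `I_2 #<= alpha k) ->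
     lie_center (gr_star (Gam n)) = [set 0%R] /\
     gcenter (Gam n) = [set 1]).
Proof.
suff main k : (k <= n)%N -> cyclic_zmod (lie_center (gr_star (Gam k))) /\
    (`I_2 #<= alpha 0%N -> lie_center (gr_star (Gam k)) = [set 0%R] /\
                           gcenter (Gam k) = [set 1]).
  by have [cyc tr] := main n (leqnn n); split=> // /(_ 0%N (leq0n n)).
have center0 (L : lieRingType) : lie_center L 0%R by move=> a; apply: lie0r.
elim: k => [|k IHk] kn.
  have F0 : @free_on (Gam 0%N) (alpha 0%N) := alpha_free 0%N kn.
  have [a2|a1] := pselect (`I_2 #<= alpha 0%N); last first.
    by split=> //; apply: free_cyclic_lie_center F0 a1.
  have Z0 : lie_center (gr_star (Gam 0%N)) = [set 0%R].
    by apply/seteqP; split=> [a /(free_lie_center F0 a2)|_ ->].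
  split=> [|_]; first by rewrite Z0; exists 0%R => // b ->; exists 0%R.
  split=> //; apply/seteqP; split=> [z zC|_ -> g]; last first.
    by rewrite /commute mul1g mulg1.
  have [b0 [b1 [Bb0 Bb1 b01]]] := card_ge2 a2.
  exact: (free_center_trivial F0 Bb0 Bb1 b01 zC).
have [cyc tr] := IHk (ltnW kn); have [s sK] := p_split k kn.
have FX : @free_on (N k) (alpha k.+1) := alpha_free k.+1 kn.
have X2 : `I_2 #<= alpha k.+1 by apply: alpha_ge2.
have triv (g : Gam k.+1) (c : {multiplicative N k -> N k}) :
    (forall x, j k (c x) = g * j k x * g^-1) ->
    forall x, lcs (N k) 2 (c x * x^-1).
  by move=> cE x; exact: (homology_trivial_ab x (action_trivial k kn g c cE)).
have inj := lie_center_map_inj (j_inj k kn) (jp_exact k kn) sK triv FX X2.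
split=> [|/tr[Z C]].
  apply: cyclic_preimage (@gr_star_mapD _ _ (p k)) _ _ inj _ cyc => //.
    by move=> x y; apply: lie_centerB.
  by move=> x; apply: lie_center_map sK _.
split; last exact: gcenter_step (j_inj k kn) (jp_exact k kn) sK FX X2 C.
apply/seteqP; split=> [a aC|_ -> //]; apply: inj => //.
by have := lie_center_map sK aC; rewrite Z.
Qed.
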